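(* Let $\Gamma=\Delta(k_1,k_2,k_3)$ be a hyperbolic triangle group and let $n\ge 1$. Let $\rho_{\mathrm{geom}}:\Gamma\to \mathrm{PGL}(2,\mathbb{R})$ be its geometric representation and let $i_{2n}:\mathrm{PGL}(2,\mathbb{R})\to\mathrm{PGL}(2n,\mathbb{R})$ be the diagonal representation. Then any continuous deformation of $i_{2n}\circ\rho_{\mathrm{geom}}$ is conjugate to $i_{2n}\circ\rho_{\mathrm{geom}}$; that is, if $(\rho_t)_{t\in[0,1]}$ is a continuous path of representations $\rho_t:\Gamma\to\mathrm{PGL}(2n,\mathbb{R})$ with $\rho_0=i_{2n}\circ\rho_{\mathrm{geom}}$, then for every $t$ the representation $\rho_t$ is conjugate to $i_{2n}\circ\rho_{\mathrm{geom}}$ by an element of $\mathrm{PGL}(2n,\mathbb{R})$.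
   Context: For positive integers $k_1,k_2,k_3$, $\Delta(k_1,k_2,k_3)=\langle a,b,c\mid a^2=b^2=c^2=(ab)^{k_1}=(bc)^{k_2}=(ac)^{k_3}=1\rangle$; it is called hyperbolic if $\frac1{k_1}+\frac1{k_2}+\frac1{k_3}<1$. Identify $\mathrm{PGL}(2,\mathbb{R})$ with the isometry group of the hyperbolic plane. The geometric representation $\rho_{\mathrm{geom}}$ maps $a,b,c$ to the reflections in the three sides of a hyperbolic triangle with interior angles $\frac{\pi}{k_1},\frac{\pi}{k_2},\frac{\pi}{k_3}$ (the sides for $a,b$ meeting at angle $\pi/k_1$, those for $b,c$ at angle $\pi/k_2$, those for $a,c$ at angle $\pi/k_3$); it is unique up to conjugation. The diagonal representation $i_{2n}$ sends the class of $A$ to the class of the diagonal action of $A$ on $\mathbb{R}^{2n}=(\mathbb{R}^2)^n$. The set $\mathrm{Hom}(\Gamma,\mathrm{PGL}(2n,\mathbb{R}))$ has the topology of pointwise convergence. *)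

(* Defs.v *)
From HB Require Import structures.
From mathcomp Require Import all_boot all_order all_algebra.
From mathcomp Require Import mxtens complex.
From mathcomp Require Import all_classical all_reals all_analysis.
Import numFieldNormedType.Exports.

Set Implicit Arguments.
Unset Strict Implicit.
Unset Printing Implicit Defensive.

Import Order.TTheory GRing.Theory Num.Theory.

Local Open Scope classical_set_scope.
Local Open Scope ring_scope.
Local Open Scope quotient_scope.

Section Presentation.
Variable I : choiceType.

(* The letter (i, false) stands for the generator i, (i, true) for its
   inverse. *)
Definition word := seq (I * bool).

Definition inv_letter (x : I * bool) : I * bool := (x.1, ~~ x.2).
Definition inv_word (w : word) : word := rev (map inv_letter w).

Variable rels : set word.

Inductive word_equiv : word -> word -> Prop :=
| word_equiv_refl w : word_equiv w w
| word_equiv_sym v w : word_equiv v w -> word_equiv w v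
| word_equiv_trans u v w : word_equiv u v -> word_equiv v w -> word_equiv u w
| word_equiv_rel u r v : rels r -> word_equiv (u ++ r ++ v) (u ++ v)
| word_equiv_cancel u x v :
    word_equiv (u ++ [:: x; inv_letter x] ++ v) (u ++ v).

Definition word_equivb (v w : word) : bool := `[< word_equiv v w >].

Lemma word_equivb_refl : reflexive word_equivb.
Proof. by move=> w; apply/asboolP/word_equiv_refl. Qed.

Lemma word_equivb_sym : symmetric word_equivb.
Proof. by move=> v w; apply/asbool_equiv_eq; split; apply: word_equiv_sym. Qed.

Lemma word_equivb_trans : transitive word_equivb.
Proof.
by move=> v u w /asboolP uv /asboolP vw; apply/asboolP/(word_equiv_trans uv vw).
Qed.

Canonical word_equiv_rel_canonical :=
  EquivRel word_equivb word_equivb_refl word_equivb_sym word_equivb_trans.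

(* The group < I | rels >. *)
Definition presented := {eq_quot word_equivb}.
HB.instance Definition _ := Choice.on presented.
HB.instance Definition _ := Quotient.on presented.

Lemma pi_presented v w :
  (\pi_presented v = \pi_presented w) <-> word_equiv v w.
Proof. by split=> [/eqquotP/asboolP//|?]; apply/eqquotP/asboolP. Qed.

Lemma word_equiv_cat2 s t v w :
  word_equiv v w -> word_equiv (s ++ v ++ t) (s ++ w ++ t).
Proof.
elim=> {v w} [w|v w _|u v w _ + _|u r v rr|u x v].
- exact: word_equiv_refl.
- exact: word_equiv_sym.
- exact: word_equiv_trans.
- by rewrite -!catA !(catA s); exact: word_equiv_rel.
- rewrite -[_ ++ _ ++ v]/(u ++ [:: x; inv_letter x] ++ v) -!catA !(catA s).
  exact: word_equiv_cancel.
Qed.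

Lemma word_equiv_cat v v' w w' :
  word_equiv v v' -> word_equiv w w' -> word_equiv (v ++ w) (v' ++ w').
Proof.
move=> /(@word_equiv_cat2 [::] w) vv' /(@word_equiv_cat2 v' [::]).
by rewrite !cats0; apply: word_equiv_trans.
Qed.

Lemma inv_letterK : involutive inv_letter.
Proof. by case=> i b; rewrite /inv_letter /= negbK. Qed.

Lemma inv_wordK : involutive inv_word.
Proof.
by move=> w; rewrite /inv_word map_rev revK -map_comp map_id_in// => x _ /=;
  rewrite inv_letterK.
Qed.

Lemma word_equiv_mulV w : word_equiv (w ++ inv_word w) [::].
Proof.
elim: w => [|x w IH]; first exact: word_equiv_refl.
have -> : (x :: w) ++ inv_word (x :: w) =
    [:: x] ++ (w ++ inv_word w) ++ [:: inv_letter x].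
  by rewrite /inv_word /= rev_cons -cats1 catA.
apply: word_equiv_trans (word_equiv_cat2 [:: x] [:: inv_letter x] IH) _.
exact: (word_equiv_cancel [::] x [::]).
Qed.

Lemma word_equiv_Vmul w : word_equiv (inv_word w ++ w) [::].
Proof. by rewrite -{2}[w]inv_wordK; exact: word_equiv_mulV. Qed.

Definition presented_one : presented := \pi_presented [::].
Definition presented_mul (x y : presented) : presented :=
  \pi_presented (repr x ++ repr y).
Definition presented_inv (x : presented) : presented := \pi_presented (inv_word (repr x)).

Lemma word_equiv_repr w : word_equiv (repr (\pi_presented w)) w.
Proof. by apply/pi_presented; rewrite reprK. Qed.

Lemma presented_mulA : associative presented_mul.
Proof.
move=> x y z; apply/pi_presented.
apply: word_equiv_trans (word_equiv_cat (word_equiv_refl _)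
  (word_equiv_repr _)) _.
rewrite catA; apply: word_equiv_cat; last exact: word_equiv_refl.
exact/word_equiv_sym/word_equiv_repr.
Qed.

Lemma presented_mul1 : left_id presented_one presented_mul.
Proof.
move=> x; rewrite -[RHS]reprK; apply/pi_presented.
exact: (word_equiv_cat (word_equiv_repr _) (word_equiv_refl _)).
Qed.

Lemma presented_mulr1 : right_id presented_one presented_mul.
Proof.
move=> x; rewrite -[RHS]reprK; apply/pi_presented; rewrite -[X in word_equiv _ X]cats0.
exact: (word_equiv_cat (word_equiv_refl _) (word_equiv_repr _)).
Qed.

Lemma presented_mulVg : left_inverse presented_one presented_inv presented_mul.
Proof.
move=> x; apply/pi_presented.
apply: word_equiv_trans (word_equiv_Vmul (repr x)).
exact: word_equiv_cat (word_equiv_repr _) (word_equiv_refl _).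
Qed.

Lemma presented_mulgV : right_inverse presented_one presented_inv presented_mul.
Proof.
move=> x; apply/pi_presented.
apply: word_equiv_trans (word_equiv_mulV (repr x)).
exact: word_equiv_cat (word_equiv_refl _) (word_equiv_repr _).
Qed.

HB.instance Definition _ := isGroup.Build presented
  presented_mulA presented_mul1 presented_mulr1 presented_mulVg presented_mulgV.

Definition presented_gen (i : I) : presented := \pi_presented [:: (i, false)].

End Presentation.

(* Delta(k1, k2, k3), on the generators 0, 1, 2 standing for a, b, c. *)
Section TriangleGroup.
Variables k1 k2 k3 : nat.

Definition letter (i : 'I_3) : 'I_3 * bool := (i, false).

Definition word_pow (w : word 'I_3) (k : nat) : word 'I_3 := flatten (nseq k w).

Let la : word 'I_3 := [:: letter (inord 0)].
Let lb : word 'I_3 := [:: letter (inord 1)].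
Let lc : word 'I_3 := [:: letter (inord 2)].

Definition triangle_relators : set (word 'I_3) :=
  [set` [:: word_pow la 2; word_pow lb 2; word_pow lc 2;
            word_pow (la ++ lb) k1; word_pow (lb ++ lc) k2;
            word_pow (la ++ lc) k3]].

Definition triangle_group := presented triangle_relators.
HB.instance Definition _ := Choice.on triangle_group.
HB.instance Definition _ := Group.on triangle_group.

Definition tri_a : triangle_group := presented_gen triangle_relators (inord 0).
Definition tri_b : triangle_group := presented_gen triangle_relators (inord 1).
Definition tri_c : triangle_group := presented_gen triangle_relators (inord 2).

End TriangleGroup.

Section PGL.
Variables (R : realType) (m : nat).

Definition GL := {A : 'M[R]_m | A \in unitmx}.
HB.instance Definition _ := Choice.on GL.
HB.instance Definition _ := SubChoice.on GL.
HB.instance Definition _ :=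
  Topological.copy GL (initial_topology (val : GL -> 'M[R]_m)).

Definition GL_one : GL := exist (fun A => A \in unitmx) 1%:M (unitmx1 R m).

Lemma GL_mul_subproof (A B : GL) : val A *m val B \in unitmx.
Proof. by rewrite unitmx_mul (valP A) (valP B). Qed.
Definition GL_mul (A B : GL) : GL :=
  exist (fun A => A \in unitmx) _ (GL_mul_subproof A B).

Lemma GL_inv_subproof (A : GL) : invmx (val A) \in unitmx.
Proof. by rewrite unitmx_inv (valP A). Qed.
Definition GL_inv (A : GL) : GL :=
  exist (fun A => A \in unitmx) _ (GL_inv_subproof A).

Lemma GL_mulA : associative GL_mul.
Proof. by move=> A B C; apply: val_inj; rewrite /= mulmxA. Qed.
Lemma GL_mul1 : left_id GL_one GL_mul.
Proof. by move=> A; apply: val_inj; rewrite /= mul1mx. Qed.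
Lemma GL_mulr1 : right_id GL_one GL_mul.
Proof. by move=> A; apply: val_inj; rewrite /= mulmx1. Qed.
Lemma GL_mulVg : left_inverse GL_one GL_inv GL_mul.
Proof. by move=> A; apply: val_inj; rewrite /= mulVmx// (valP A). Qed.
Lemma GL_mulgV : right_inverse GL_one GL_inv GL_mul.
Proof. by move=> A; apply: val_inj; rewrite /= mulmxV// (valP A). Qed.

HB.instance Definition _ := isGroup.Build GL
  GL_mulA GL_mul1 GL_mulr1 GL_mulVg GL_mulgV.

Definition scal_equiv (A B : GL) : bool :=
  `[< exists2 c : R, c != 0 & val A = c *: val B >].

Lemma scal_equiv_refl : reflexive scal_equiv.
Proof. by move=> A; apply/asboolP; exists 1; rewrite ?oner_eq0 ?scale1r. Qed.

Lemma scal_equiv_sym : symmetric scal_equiv.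
Proof.
move=> A B; apply/asbool_equiv_eq.
by split=> -[c c0 ->]; exists c^-1; rewrite ?invr_eq0 ?scalerA ?mulVf ?scale1r.
Qed.

Lemma scal_equiv_trans : transitive scal_equiv.
Proof.
move=> B A C /asboolP[c c0 AB] /asboolP[d d0 BC]; apply/asboolP.
by exists (c * d); rewrite ?mulf_neq0// AB BC scalerA.
Qed.

Canonical scal_equiv_canonical :=
  EquivRel scal_equiv scal_equiv_refl scal_equiv_sym scal_equiv_trans.

Definition PGL := quotient_topology {eq_quot scal_equiv}.
HB.instance Definition _ := Choice.on PGL.
HB.instance Definition _ := Quotient.on PGL.
HB.instance Definition _ := Topological.on PGL.

Lemma pi_PGL (A B : GL) :
  \pi_PGL A = \pi_PGL B <-> exists2 c : R, c != 0 & val A = c *: val B.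
Proof. by split=> [/eqquotP/asboolP//|?]; apply/eqquotP/asboolP. Qed.

Lemma repr_PGL (A : GL) :
  exists2 c : R, c != 0 & val (repr (\pi_PGL A)) = c *: val A.
Proof. by apply/pi_PGL; rewrite reprK. Qed.

Definition PGL_one : PGL := \pi_PGL 1%g.
Definition PGL_mul (x y : PGL) : PGL := \pi_PGL (repr x * repr y)%g.
Definition PGL_inv (x : PGL) : PGL := \pi_PGL (repr x)^-1%g.

Lemma pi_PGLM (A B : GL) : PGL_mul (\pi_PGL A) (\pi_PGL B) = \pi_PGL (A * B)%g.
Proof.
have [c c0 Ec] := repr_PGL A; have [d d0 Ed] := repr_PGL B.
apply/pi_PGL; exists (c * d); rewrite ?mulf_neq0//=.
by rewrite Ec Ed -scalemxAl -scalemxAr scalerA.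
Qed.

Lemma pi_PGLV (A : GL) : PGL_inv (\pi_PGL A) = \pi_PGL A^-1%g.
Proof.
have [c c0 Ec] := repr_PGL A.
apply/pi_PGL; exists c^-1; rewrite ?invr_eq0//=.
by rewrite Ec invmxZ// -Ec; exact: (valP (repr _)).
Qed.

Lemma PGL_mulA : associative PGL_mul.
Proof.
elim/quotW => x; elim/quotW => y; elim/quotW => z.
by rewrite (pi_PGLM y z) (pi_PGLM x y) !pi_PGLM mulgA.
Qed.
Lemma PGL_mul1 : left_id PGL_one PGL_mul.
Proof. by elim/quotW => x; rewrite pi_PGLM mul1g. Qed.
Lemma PGL_mulr1 : right_id PGL_one PGL_mul.
Proof. by elim/quotW => x; rewrite pi_PGLM mulg1. Qed.
Lemma PGL_mulVg : left_inverse PGL_one PGL_inv PGL_mul.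
Proof. by elim/quotW => x; rewrite pi_PGLV pi_PGLM mulVg. Qed.
Lemma PGL_mulgV : right_inverse PGL_one PGL_inv PGL_mul.
Proof. by elim/quotW => x; rewrite pi_PGLV pi_PGLM mulgV. Qed.

HB.instance Definition _ := isGroup.Build PGL
  PGL_mulA PGL_mul1 PGL_mulr1 PGL_mulVg PGL_mulgV.

End PGL.

Section DiagonalRepresentation.
Variables (R : realType) (n : nat).

Lemma tensmx11 : tensmx (1%:M : 'M[R]_n) (1%:M : 'M[R]_2) = 1%:M.
Proof.
apply/matrixP => i j; case: (mxtens_indexP i) => i0 i1.
case: (mxtens_indexP j) => j0 j1; rewrite tensmxE !mxE -natrM mulnb.
by rewrite (can_eq (@mxtens_indexK _ _)) xpair_eqE.
Qed.

Lemma diag_GL_subproof (A : GL R 2) :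
  tensmx (1%:M : 'M[R]_n) (val A) \in unitmx.
Proof.
have : tensmx (1%:M : 'M[R]_n) (val A) *m
       tensmx (1%:M : 'M[R]_n) (invmx (val A)) = 1%:M.
  by rewrite tensmx_mul mul1mx mulmxV ?(valP A)// tensmx11.
by case/mulmx1_unit.
Qed.

(* The Kronecker product of 1 with A is block diagonal with n blocks A: its entry
   at (2 i + k, 2 j + l) is A k l if i = j and 0 otherwise. *)
Definition diag_GL (A : GL R 2) : GL R (n * 2) :=
  exist (fun B => B \in unitmx) _ (diag_GL_subproof A).

Definition diag_rep (x : PGL R 2) : PGL R (n * 2) :=
  \pi_(PGL R (n * 2)) (diag_GL (repr x)).

Lemma diag_rep_pi (A : GL R 2) :
  diag_rep (\pi_(PGL R 2) A) = \pi_(PGL R (n * 2)) (diag_GL A).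
Proof.
have [c c0 Ec] := repr_PGL A.
apply/pi_PGL; exists c => //=.
by rewrite Ec; apply/matrixP => i j; rewrite !mxE mulrCA.
Qed.

Lemma diag_repM : {morph diag_rep : x y / (x * y)%g}.
Proof.
elim/quotW => x; elim/quotW => y; rewrite [X in diag_rep X]pi_PGLM.
rewrite !diag_rep_pi [RHS]pi_PGLM; congr \pi_(_); apply: val_inj => /=.
by rewrite tensmx_mul mul1mx.
Qed.

HB.instance Definition _ := isMultiplicative.Build _ _ diag_rep diag_repM.

End DiagonalRepresentation.

(* The hyperbolic plane is the upper half-plane model. *)
Section HyperbolicPlane.
Variable R : realType.
Local Open Scope complex_scope.
Implicit Types (p q r z w u v : R[i]) (g : PGL R 2).

Definition upper_half_plane : set R[i] := [set z | 0 < complex.Im z].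

Definition arcosh (x : R) : R := ln (x + Num.sqrt (x ^+ 2 - 1)).

Definition hdist z w : R :=
  arcosh (1 + ((complex.Re z - complex.Re w) ^+ 2 +
               (complex.Im z - complex.Im w) ^+ 2) /
              (2 * complex.Im z * complex.Im w)).

(* The isometry of the upper half-plane given by the class of A: the Moebius
   map z |-> (a z + b) / (c z + d) if det A > 0, its precomposition with complex
   conjugation if det A < 0. *)
Definition moebius_mx (A : 'M[R]_2) z : R[i] :=
  let w := if 0 < \det A then z else z^* in
  ((A 0 0)%:C * w + (A 0 1)%:C) / ((A 1 0)%:C * w + (A 1 1)%:C).

Definition moebius g z : R[i] := moebius_mx (val (repr g)) z.

(* The geodesic segment from p to q. *)
Definition side p q : set R[i] :=
  [set z | upper_half_plane z /\ hdist p z + hdist z q = hdist p q].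

(* R[i] as a numFieldType has the topology given by its norm. *)
Let C : numFieldType := R[i].

(* u is the Euclidean unit vector tangent at p to the side from p to q. *)
Definition side_direction (p q u : C) : Prop :=
  (z - p) / `|z - p| @[z --> within (side p q `\ p) (nbhs p)] --> u.

(* The hyperbolic metric of the half-plane is conformal, so that hyperbolic
   angles are Euclidean angles between tangent vectors. *)
Definition interior_angle p q r (theta : R) : Prop :=
  exists u v, [/\ side_direction p q u, side_direction p r v &
                  theta = acos (complex.Re (u * v^*))].

Definition hyperbolic_triangle p q r : Prop :=
  [/\ upper_half_plane p, upper_half_plane q & upper_half_plane r] /\
  [/\ ~ side q r p, ~ side p r q & ~ side p q r].

(* The reflection in the side from p to q is the only nontrivial isometry that
   fixes this side pointwise. *)
Definition is_reflection g p q : Prop :=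
  g <> 1%g /\ forall z, side p q z -> moebius g z = z.

Definition geometric_rep k1 k2 k3
    (rho : {multiplicative triangle_group k1 k2 k3 -> PGL R 2}) : Prop :=
  exists pab pbc pac,
    [/\ hyperbolic_triangle pab pbc pac,
        [/\ interior_angle pab pac pbc (pi / k1%:R),
            interior_angle pbc pab pac (pi / k2%:R) &
            interior_angle pac pab pbc (pi / k3%:R)] &
        [/\ is_reflection (rho (tri_a k1 k2 k3)) pab pac,
            is_reflection (rho (tri_b k1 k2 k3)) pab pbc &
            is_reflection (rho (tri_c k1 k2 k3)) pbc pac]].

End HyperbolicPlane.

Definition conjugate_reps (H G : groupType) (rho sigma : H -> G) : Prop :=
  exists g : G, forall x, rho x = (g * sigma x * g^-1)%g.

(* Main.v *)
Require Import Defs.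
From HB Require Import structures.
From mathcomp Require Import all_boot all_order all_algebra perm separable cyclotomic.
From mathcomp Require Import mxtens complex.
From mathcomp Require Import all_classical all_reals all_analysis.
From mathcomp Require Import ring lra.
Import numFieldNormedType.Exports.

(** Why deformations are trivial.  An element x of PGL(m, R) has a lift N to a
    matrix of determinant 1 or -1, unique up to sign, so tr(N)^2 and tr(N^2) are
    continuous functions of x.  When x has finite order, N is a root of the
    identity, its eigenvalues are roots of unity of bounded order, and these
    traces take finitely many values; along a path on which x keeps a bounded
    order they are therefore constant ([torsion_traces_constant]).

    At time 0 the generators a, b, c lift to block sums A, B, C of trace-zero
    involutions of the plane, for which AB + BA = 2x, BC + CB = 2y and
    AC + CA = 2z are scalar: they generate a Clifford algebra of a ternary
    quadratic form, with Gram matrix given by x, y, z.  Constancy of the traces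
    preserves these relations.  The trace of A^2 keeps A an involution.  With
    X = AB, of finite order and inverse BA, the element S = X + X^-1 is
    diagonalisable with real eigenvalues, and tr(X)^2 and tr(X^2) determine
    the trace of (S - s)^2 for a suitable scalar s; it vanishes at time 0, hence
    always, so S stays scalar ([anticommutator_stays]).  Thus x, y, z are
    constant up to sign; tr(ABAC)^2 shows that xyz is constant, and the other
    signs disappear by changing the signs of A, B, C.

    The centre of such a Clifford algebra is spanned by 1 and the pseudoscalar
    h = ABC - (yA - zB + xC), whose square is a scalar depending on x, y, z
    only.  At time 0, h is a scalar e, and e is not 0.  So h/e is always an
    involution, its trace takes finitely many values, tr(ABC)^2 = tr(h)^2 is
    constant, and at time 0 it has the largest value possible for an involution;
    hence h = e or h = -e throughout ([clifford_triple_stays]).  The quotient of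
    the Clifford algebra by h = e is an algebra of two by two matrices, so that
    its representations of a given dimension are all conjugate.  Concretely, C
    is a polynomial in A and B, the pair A, B can be traded for a pair of
    anticommuting involutions, and any two such pairs of the same size are
    conjugate ([clifford_triples_conjugate]).

    The geometry of the triangle gives that e is not 0 and x^2 < 1.  A
    reflection in a side fixes its end points, which forces its matrix to have
    trace zero and negative determinant and to lie in the kernel of a linear form
    attached to each of them.  It is not in the kernel of the form of the opposite
    vertex: hyperbolic distance along a geodesic is the difference of a real parameter,
    so of three vertices on a common geodesic one would lie on the side joining
    the other two.  Hence the three reflections are linearly independent
    ([geometric_clifford_triple]). *)

Set Implicit Arguments.
Unset Strict Implicit.
Unset Printing Implicit Defensive.

Import Order.TTheory GRing.Theory Num.Theory.

Local Open Scope classical_set_scope.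
Local Open Scope ring_scope.
Local Open Scope quotient_scope.

(** * Traces of matrices of finite order *)

(** The polynomial X^k - 1 is separable, so the minimal polynomial of [N] splits
    with simple roots. *)
Lemma mxX_eq1_diagonalizable (F : numClosedFieldType) (m k : nat) (N : 'M[F]_m) :
  (0 < k)%N -> N ^+ k = 1 ->
  exists P : 'M[F]_m, exists2 d : 'rV[F]_m,
    P \in unitmx & N = invmx P *m diag_mx d *m P /\ forall i, d 0 i ^+ k = 1.
Proof.
case: m N => [|m] N k_gt0 Nk1.
  exists 1, 0; rewrite ?unitmx1//; split; last by case.
  by apply/matrixP => -[].
have [rs Ers] := closed_field_poly_normal ('X^k - 1 : {poly F}).
rewrite (monicP (monic_Xn_sub_1 F k_gt0)) scale1r in Ers.
have rs_uniq : uniq rs.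
  rewrite -separable_prod_XsubC -Ers separable_Xn_sub_1//.
  by rewrite pnatr_eq0 -lt0n.
have : diagonalizable N.
  apply/diagonalizableP; exists rs => //; rewrite -Ers.
  apply: mxminpoly_min.
  by rewrite rmorphB rmorphXn rmorph1 /= horner_mx_X Nk1 subrr.
case=> P Pu /diagonalizable_forPex[d /(simmxP Pu) PN].
exists P, d => //.
have EN : N = invmx P *m diag_mx d *m P by rewrite -mulmxA -PN mulKmx.
split=> // i.
have PNj j : P *m N ^+ j = diag_mx (\row_i d 0 i ^+ j) *m P.
  elim: j => [|j IH].
    rewrite expr0 mulmx1 [diag_mx _](_ : _ = 1) ?mul1mx//.
    by apply/matrixP => a b; rewrite !mxE expr0.
  rewrite exprSr mulmxA IH -mulmxA PN mulmxA mulmx_diag; congr (diag_mx _ *m _).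
  by apply/rowP => a; rewrite !mxE exprSr.
have := PNj k; rewrite Nk1 mulmx1 => /(congr1 (mulmxr (invmx P))).
rewrite /= -mulmxA mulmxV// mulmx1 => /matrixP/(_ i i).
by rewrite !mxE eqxx mulr1n.
Qed.

Lemma map_mxX (R S : pzRingType) (j : {rmorphism R -> S}) (m k : nat)
    (N : 'M[R]_m) : map_mx j (N ^+ k) = map_mx j N ^+ k.
Proof.
elim: k => [|k IH]; first by rewrite !expr0 map_mx1.
by rewrite !exprS -IH; exact: map_mxM.
Qed.

(** The trace is a sum of [m] complex roots of unity of order dividing [k]. *)
Lemma mxtrace_torsion_finite (R : rcfType) (m k : nat) : (0 < k)%N ->
  exists L : seq R, forall N : 'M[R]_m, N ^+ k = 1 -> \tr N \in L.
Proof.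
move=> k_gt0.
have [rs Ers] := closed_field_poly_normal ('X^k - 1 : {poly R[i]}).
rewrite (monicP (monic_Xn_sub_1 _ k_gt0)) scale1r in Ers.
pose f (u : {ffun 'I_m -> seq_sub rs}) : R := complex.Re (\sum_i ssval (u i)).
exists [seq f u | u <- enum {ffun 'I_m -> seq_sub rs}] => N Nk1.
pose j : {rmorphism R -> R[i]} := real_complex R.
have Nk1' : map_mx j N ^+ k = 1 by rewrite -map_mxX Nk1 map_mx1.
have [P [d Pu [EN dk]]] := mxX_eq1_diagonalizable k_gt0 Nk1'.
have drs i : d 0 i \in rs.
  rewrite -root_prod_XsubC -Ers rootE !hornerE.
  by rewrite dk subrr.
apply/mapP; exists [ffun i => SeqSub (drs i)]; first by rewrite mem_enum.
rewrite /f; under eq_bigr do rewrite ffunE/=.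
transitivity (complex.Re (j (\tr N))) => //.
by rewrite -trace_map_mx EN -mulmxA mxtrace_mulC mulmxK// mxtrace_diag.
Qed.

(** In an eigenbasis [X + Y] is diagonal with entries d + d^-1 = d + d^*, which
    are real.  The hypothesis says that a sum of squares of real numbers is zero,
    so each of them is zero. *)
Lemma torsion_plus_inverse_scalar_closed (C : numClosedFieldType) (m k : nat)
    (X Y : 'M[C]_m) (s : C) :
  (0 < k)%N -> s \is Num.real -> X ^+ k = 1 -> Y *m X = 1%:M ->
  \tr ((X + Y - s%:M) *m (X + Y - s%:M)) = 0 -> X + Y = s%:M.
Proof.
move=> k_gt0 s_real Xk1 YX tr0.
have [P [d Pu [EX dk]]] := mxX_eq1_diagonalizable k_gt0 Xk1.
pose e := \row_i (d 0 i + (d 0 i)^* - s).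
have dd i : (d 0 i)^* * d 0 i = 1.
  have : `|d 0 i| ^+ k == 1 by rewrite -normrX dk normr1.
  by rewrite mulrC -normCK pexpr_eq1 -?lt0n// => /eqP ->; rewrite expr1n.
have EY : Y = invmx P *m diag_mx (\row_i (d 0 i)^*) *m P.
  have [_ Xu] := mulmx1_unit YX.
  apply: (can_inj (mulmxK Xu)); rewrite YX EX !mulmxA mulmxK//.
  rewrite -(mulmxA (invmx P)) mulmx_diag.
  rewrite [diag_mx _](_ : _ = 1%:M) ?mulmx1 ?mulVmx//.
  by apply/matrixP => a b; rewrite !mxE dd.
have ES : X + Y - s%:M = invmx P *m diag_mx e *m P.
  rewrite EX EY.
  have -> : diag_mx e = diag_mx d + diag_mx (\row_i (d 0 i)^*) - s%:M.
    by apply/matrixP => a b; rewrite !mxE mulrnBl mulrnDl.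
  rewrite mulmxBr mulmxBl mulmxDr mulmxDl; congr (_ - _).
  by rewrite mul_mx_scalar -scalemxAl mulVmx// scalemx1.
have : \sum_i e 0 i ^+ 2 = 0.
  rewrite -[RHS]tr0 ES -!mulmxA mulKVmx// mxtrace_mulC !mulmxA mulmxK// mulmx_diag.
  by rewrite mxtrace_diag; apply: eq_bigr => i _; rewrite !mxE expr2.
have e_real i : e 0 i \is Num.real.
  rewrite mxE rpredB//.
  by rewrite CrealE rmorphD /= conjCK addrC.
move=> /psumr_eq0P e0.
have {}e0 : e = 0.
  apply/rowP => i; rewrite [RHS]mxE; apply/eqP; rewrite -sqrf_eq0; apply/eqP.
  by apply: e0 => // a _; rewrite real_exprn_even_ge0.
apply/eqP; rewrite -subr_eq0 ES e0; apply/eqP.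
by rewrite raddf0 mulmx0 mul0mx.
Qed.

Lemma torsion_plus_inverse_scalar (R : rcfType) (m k : nat) (X Y : 'M[R]_m) (s : R) :
  (0 < k)%N -> X ^+ k = 1 -> Y *m X = 1%:M ->
  \tr ((X + Y - s%:M) *m (X + Y - s%:M)) = 0 -> X + Y = s%:M.
Proof.
move=> k_gt0 Xk1 YX tr0.
pose j : {rmorphism R -> R[i]} := real_complex R.
have ES : map_mx j (X + Y - s%:M) = map_mx j X + map_mx j Y - (j s)%:M.
  by rewrite map_mxB map_mxD map_scalar_mx.
apply: (map_mx_inj (f := j)); rewrite map_mxD map_scalar_mx.
apply: (torsion_plus_inverse_scalar_closed k_gt0).
- by rewrite /j/= complex_real.
- by rewrite -map_mxX Xk1 map_mx1.
- by rewrite -map_mxM YX map_mx1.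
- by rewrite -ES -map_mxM trace_map_mx tr0 rmorph0.
Qed.

Lemma mxtrace_scalar_mull (R : pzRingType) (m : nat) (a : R) :
  \tr (a%:M : 'M[R]_m) = m%:R * a.
Proof. by rewrite mxtrace_scalar mulr_natl. Qed.

Lemma mxtrace_shift_sqr (R : comPzRingType) (m : nat) (S : 'M[R]_m) (s : R) :
  \tr ((S - s%:M) *m (S - s%:M)) = \tr (S *m S) - 2 * s * \tr S + m%:R * s ^+ 2.
Proof.
rewrite mulmxBl mul_scalar_mx mulmxBr mul_mx_scalar.
by rewrite !raddfB/= !mxtraceZ ?raddfB/= ?mxtraceZ mxtrace_scalar_mull; ring.
Qed.

(** An involution is its own inverse, so that the trace of (2J - 2s)^2 is
    determined by that of [J]. *)
Lemma involution_extremal_trace (R : rcfType) (m : nat) (J : 'M[R]_m) (s : R) :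
  J *m J = 1%:M -> s ^+ 2 = 1 -> \tr J = m%:R * s -> J = s%:M.
Proof.
move=> JJ s1 trJ.
have : J + J = (2 * s)%:M.
  apply: (@torsion_plus_inverse_scalar R m 2); rewrite ?expr2//.
  rewrite mxtrace_shift_sqr mulmxDl !mulmxDr JJ !raddfD/= mxtrace_scalar_mull trJ.
  transitivity (4 * m%:R * (1 - s ^+ 2)); first by ring.
  by rewrite s1 subrr mulr0.
by rewrite -mulr2n -scaler_nat -scale_scalar_mx => /scalerI -> //.
Qed.

(** * Continuous invariants of projective classes *)

(** If [f t] differs from [f 0], then by the intermediate value theorem [f] takes
    the infinitely many values f 0 + (f t - f 0) / (j + 1). *)
Lemma continuous_finite_valued_constant (R : realType) (f : R -> R) (L : seq R) :
  {within `[0, 1], continuous f} ->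
  (forall t, 0 <= t <= 1 -> f t \in L) -> forall t, 0 <= t <= 1 -> f t = f 0.
Proof.
move=> cf fL t /andP[t0 t1]; apply/eqP/negPn/negP => ft.
have cft : {within `[0, t], continuous f}.
  apply: continuous_subspaceW cf => s /=; rewrite !in_itv/= => /andP[-> st].
  exact: le_trans st t1.
pose v (j : nat) := f 0 + (f t - f 0) / j.+1%:R.
have vL j : v j \in L.
  have [|c] := @IVT _ f 0 t (v j) t0 cft.
    have u0 : 0 <= j.+1%:R^-1 :> R by rewrite invr_ge0.
    have u1 : j.+1%:R^-1 <= 1 :> R by rewrite invf_le1// ler1n.
    rewrite ge_min le_max /v; move: (j.+1%:R^-1) u0 u1 => u u0 u1.
    by have [h|h] := lerP (f 0) (f t); apply/andP; split; apply/orP;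
      [left|right|right|left]; nra.
  rewrite in_itv/= => /andP[c0 ct] <-; apply: fL.
  by rewrite c0 (le_trans ct).
have v_inj : injective v.
  move=> i j /addrI /(mulfI _) h; apply/eqP.
  have ft0 : f t - f 0 != 0 by rewrite subr_eq0.
  have /invr_inj/eqP := h ft0.
  by rewrite eqr_nat eqSS.
have : (size (map v (iota 0 (size L).+1)) <= size L)%N.
  apply: uniq_leq_size; first by rewrite map_inj_uniq ?iota_uniq.
  by move=> _ /mapP[j _ ->].
by rewrite size_map size_iota ltnn.
Qed.

Section UnimodularLift.
Variables (R : realType) (m : nat).
Hypothesis m_gt0 : (0 < m)%N.
Implicit Types (x y : PGL R m) (A : GL R m) (N : 'M[R]_m).

Definition unimodular_scale N : R := expR (- ln `|\det N| / m%:R).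

Definition unimodular N := unimodular_scale N *: N.

(** A relation rather than a chosen lift, so that lifts can be multiplied and their
    signs adjusted. *)
Definition unimodular_lift x N :=
  exists2 A : GL R m, x = \pi_(PGL R m) A /\ N = val A & `|\det N| = 1.

Let mR0 : m%:R != 0 :> R. Proof. by rewrite pnatr_eq0 -lt0n. Qed.

Let det_GL A : \det (val A) != 0.
Proof. by rewrite -unitfE -unitmxE (valP A). Qed.

Lemma unimodularZ (c : R) A : c != 0 ->
  unimodular (c *: val A) = Num.sg c *: unimodular (val A).
Proof.
move=> c0; have nc : 0 < `|c| by rewrite normr_gt0.
have nd : 0 < `|\det (val A)| by rewrite normr_gt0.
rewrite /unimodular !scalerA; congr (_ *: _).
rewrite /unimodular_scale detZ normrM normrX lnM ?posrE ?exprn_gt0// lnXn//.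
rewrite opprD mulrDl expRD -mulNrn -(mulr_natr (- ln `|c|)) mulfK// expRN lnK ?posrE//.
by rewrite mulrC mulrA -[c in c / _]mulr_sg_norm mulfK ?normr_eq0.
Qed.

Lemma norm_det_unimodular A : `|\det (unimodular (val A))| = 1.
Proof.
rewrite detZ normrM normrX gtr0_norm ?expR_gt0// -expRM_natr divfK//.
by rewrite expRN lnK ?posrE ?normr_gt0// mulVf// normr_eq0.
Qed.

Lemma unimodular_id N : `|\det N| = 1 -> unimodular N = N.
Proof.
move=> N1; rewrite /unimodular /unimodular_scale N1.
by rewrite ln1 oppr0 mul0r expR0 scale1r.
Qed.

Lemma unimodular_lift_exists x : exists N, unimodular_lift x N.
Proof.
exists (unimodular (val (repr x))).
have c0 : unimodular_scale (val (repr x)) != 0 by rewrite gt_eqF// expR_gt0.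
have u : unimodular (val (repr x)) \in unitmx.
  by rewrite unitmxE detZ unitfE mulf_neq0// expf_neq0.
exists (exist (fun B => B \in unitmx) _ u); last exact: norm_det_unimodular.
split=> //; rewrite -[LHS]reprK; apply/esym/pi_PGL.
by exists (unimodular_scale (val (repr x))).
Qed.

Lemma unimodular_liftM x y N N' :
  unimodular_lift x N -> unimodular_lift y N' -> unimodular_lift (x * y)%g (N *m N').
Proof.
move=> [A [-> ->] A1] [B [-> ->] B1]; exists (A * B)%g.
  by split=> //; rewrite [LHS]pi_PGLM.
by rewrite det_mulmx normrM A1 B1 mulr1.
Qed.

Lemma unimodular_lift_sign x N (s : R) :
  s ^+ 2 = 1 -> unimodular_lift x N -> unimodular_lift x (s *: N).
Proof.
move=> s1 [A [-> ->] A1].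
have s0 : s != 0 by rewrite -sqrf_eq0 s1 oner_eq0.
have ns : `|s| = 1 by apply/eqP; rewrite -(@pexpr_eq1 _ _ 2)// -normrX s1 normr1.
have u : s *: val A \in unitmx.
  by rewrite unitmxE detZ unitfE mulf_neq0// expf_neq0.
exists (exist (fun B => B \in unitmx) _ u); last first.
  by rewrite detZ normrM normrX ns expr1n mul1r A1.
by split=> //; apply/esym/pi_PGL; exists s.
Qed.

Lemma unimodular_lift_uniq x N N' :
  unimodular_lift x N -> unimodular_lift x N' ->
  exists2 s : R, s ^+ 2 = 1 & N = s *: N'.
Proof.
move=> [A [-> ->] A1] [B [/pi_PGL[c c0 EA] ->] B1]; exists c => //.
move: A1; rewrite EA detZ normrM normrX B1 mulr1 => /eqP.
by rewrite pexpr_eq1 -?lt0n// => /eqP c1; rewrite -[LHS]real_normK ?num_real// c1 expr1n.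
Qed.

Lemma unimodular_lift1 : unimodular_lift 1%g 1%:M.
Proof. by exists 1%g => //; rewrite det1 normr1. Qed.

Lemma unimodular_liftX x N k :
  unimodular_lift x N -> unimodular_lift (x ^+ k)%g (N ^+ k).
Proof.
move=> xN; elim: k => [|k IH]; first exact: unimodular_lift1.
rewrite expgS exprS; exact: unimodular_liftM.
Qed.

Lemma unimodular_lift_torsion x N k :
  unimodular_lift x N -> (x ^+ k)%g = 1%g -> N ^+ (k * 2) = 1.
Proof.
move=> xN xk1; have := unimodular_liftX k xN; rewrite xk1 => h.
have [s s1 E] := unimodular_lift_uniq h unimodular_lift1.
rewrite exprM E expr2 -[_ * _]/(_ *m _) -scalemxAl -scalemxAr scalerA mulmx1.
by rewrite -expr2 s1 scale1r.
Qed.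

Lemma conjugate_unimodular_lift x y N N' (g : GL R m) :
  unimodular_lift x N -> unimodular_lift y N' -> val g *m N' = N *m val g ->
  x = (\pi_(PGL R m) g * y * (\pi_(PGL R m) g)^-1)%g.
Proof.
move=> [A [-> ->] _] [B [-> ->] _] E.
suff -> : (A = g * B * g^-1)%g.
  transitivity (PGL_mul (PGL_mul (\pi_(PGL R m) g) (\pi_(PGL R m) B))
                        (PGL_inv (\pi_(PGL R m) g))) => //.
  by rewrite pi_PGLM pi_PGLV pi_PGLM.
apply: val_inj; rewrite /= E mulmxK//; exact: (valP g).
Qed.

(** The two invariants below are even in the matrix, so they do not depend on the
    representative of [x]. *)
Definition trace_sqr x : R := \tr (unimodular (val (repr x))) ^+ 2.

Definition trace_of_sqr x : R :=
  \tr (unimodular (val (repr x)) *m unimodular (val (repr x))).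

Lemma unimodular_repr A :
  exists2 s : R, s ^+ 2 = 1 &
    unimodular (val (repr (\pi_(PGL R m) A))) = s *: unimodular (val A).
Proof.
have [c c0 ->] := repr_PGL A; exists (Num.sg c); last by rewrite unimodularZ.
by rewrite sqr_sg c0.
Qed.

Lemma trace_sqr_pi A : trace_sqr (\pi_(PGL R m) A) = \tr (unimodular (val A)) ^+ 2.
Proof.
have [s s1 E] := unimodular_repr A.
by rewrite /trace_sqr E mxtraceZ exprMn s1 mul1r.
Qed.

Lemma trace_of_sqr_pi A :
  trace_of_sqr (\pi_(PGL R m) A) = \tr (unimodular (val A) *m unimodular (val A)).
Proof.
have [s s1 E] := unimodular_repr A.
by rewrite /trace_of_sqr E -scalemxAl -scalemxAr scalerA -expr2 s1 scale1r.
Qed.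

Lemma trace_sqr_lift x N : unimodular_lift x N -> trace_sqr x = \tr N ^+ 2.
Proof. by move=> [A [-> ->] A1]; rewrite trace_sqr_pi unimodular_id. Qed.

Lemma trace_of_sqr_lift x N : unimodular_lift x N -> trace_of_sqr x = \tr (N *m N).
Proof. by move=> [A [-> ->] A1]; rewrite trace_of_sqr_pi unimodular_id. Qed.

Let coord_GL i j : continuous (fun A : GL R m => val A i j).
Proof.
move=> A; apply: (@continuous_comp _ _ _ (val : GL R m -> 'M[R]_m) (fun M => M i j)).
  exact: initial_continuous.
exact: coord_continuous.
Qed.

Let continuous_mulR (T : topologicalType) (f g : T -> R) :
  continuous f -> continuous g -> continuous (fun u => f u * g u).
Proof. by move=> cf cg u; exact: continuousM (cf u) (cg u). Qed.

Let continuous_det_GL : continuous (fun A : GL R m => \det (val A)).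
Proof.
rewrite /determinant; apply: continuous_big => [|s _].
  by move=> p; apply: continuousD; [exact: cvg_fst|exact: cvg_snd].
apply: continuous_mulR; first by move=> ?; exact: cst_continuous.
refine (@continuous_big R 'I_m *%R 1 predT _ _ _ (fun i (A : GL R m) => val A i (s i)) _).
  by move=> p; apply: continuousM; [exact: cvg_fst|exact: cvg_snd].
by move=> i _; exact: coord_GL.
Qed.

Let continuous_unimodular_scale : continuous (fun A : GL R m => unimodular_scale (val A)).
Proof.
move=> A.
apply: (@continuous_comp _ _ _ (fun A : GL R m => - ln `|\det (val A)| / m%:R) expR);
  last exact: continuous_expR.
apply: continuousM; last exact: cst_continuous.
apply: continuousN.
apply: (@continuous_comp _ _ _ (fun A : GL R m => `|\det (val A)|) (@ln R)).
  apply: (@continuous_comp _ _ _ (fun A : GL R m => \det (val A)) Num.norm).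
    exact: continuous_det_GL.
  exact: norm_continuous.
by apply: continuous_ln; rewrite normr_gt0.
Qed.

Let continuous_unimodular i j : continuous (fun A : GL R m => unimodular (val A) i j).
Proof.
under eq_fun do rewrite mxE.
by apply: continuous_mulR; [exact: continuous_unimodular_scale|exact: coord_GL].
Qed.

Let continuous_sumR (T : topologicalType) (I : finType) (F : I -> T -> R) :
  (forall i, continuous (F i)) -> continuous (fun u => \sum_i F i u).
Proof.
move=> cF; apply: continuous_big => [|i _]; last exact: cF.
by move=> p; apply: continuousD; [exact: cvg_fst|exact: cvg_snd].
Qed.

(** By the universal property of the quotient topology, continuity can be tested
    on GL, where the invariant is given by a formula in the entries. *)
Lemma continuous_trace_sqr : continuous (trace_sqr : PGL R m -> R).
Proof.
apply/quotient_continuous => /=.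
rewrite (_ : _ \o _ = fun A : GL R m =>
    (\sum_i unimodular (val A) i i) * \sum_i unimodular (val A) i i).
  by apply: continuous_mulR; apply: continuous_sumR => i; exact: continuous_unimodular.
by apply/funext => A; rewrite /= trace_sqr_pi expr2.
Qed.

Lemma continuous_trace_of_sqr : continuous (trace_of_sqr : PGL R m -> R).
Proof.
apply/quotient_continuous => /=.
rewrite (_ : _ \o _ = fun A : GL R m =>
    \sum_i \sum_j unimodular (val A) i j * unimodular (val A) j i).
  apply: continuous_sumR => i; apply: continuous_sumR => j.
  by apply: continuous_mulR; exact: continuous_unimodular.
apply/funext => A; rewrite /= trace_of_sqr_pi.
by apply: eq_bigr => i _; rewrite mxE.
Qed.

End UnimodularLift.

Lemma invariant_constant (R : realType) (G : choiceType) (m : nat)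
    (rho : R -> G -> PGL R m) (phi : PGL R m -> R) (L : seq R) (x : G) :
  {within `[0, 1], continuous (rho : R -> {ptws G -> PGL R m})} ->
  continuous phi -> (forall t, 0 <= t <= 1 -> phi (rho t x) \in L) ->
  forall t, 0 <= t <= 1 -> phi (rho t x) = phi (rho 0 x).
Proof.
move=> crho cphi; apply: continuous_finite_valued_constant.
have cev : continuous (fun f : {ptws G -> PGL R m} => phi (f x)).
  move=> f; apply: (@continuous_comp {ptws G -> PGL R m} _ _ (fun f => f x)).
    exact: (@proj_continuous G (fun=> PGL R m) x).
  exact: cphi.
exact: (@within_continuous_comp _ _ _ _ (rho : R -> {ptws G -> PGL R m}) _ (in1W cev)).
Qed.

(** * Pairs of involutions *)

(** [U] is a basis of the fixed vectors of [J]; since [K] anticommutes with [J], it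
    exchanges them with the vectors that [J] negates, for which [V] is a basis.
    In the basis [U], [V] the matrices of [J] and [K] depend only on [r], which is
    half of [m]. *)
Lemma anticommuting_involutions_basis (R : realFieldType) (m : nat) (J K : 'M[R]_m) :
  J *m J = 1%:M -> K *m K = 1%:M -> J *m K = - (K *m J) ->
  exists r (U V : 'M[R]_(r, m)),
    [/\ (r + r)%N = m, row_free (col_mx U V), U *m J = U & V *m J = - V] /\
    U *m K = V /\ V *m K = U.
Proof.
move=> JJ KK JK.
(* The projection onto the fixed vectors of J. *)
pose P := 2^-1 *: (1%:M + J).
have PJ : P *m J = P by rewrite /P -scalemxAl mulmxDl mul1mx JJ addrC.
exists (\rank P), (row_base P), (row_base P *m K).
have UJ : row_base P *m J = row_base P.
  have /submxP[W ->] : (row_base P <= P)%MS by rewrite eq_row_base.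
  by rewrite -mulmxA PJ.
have VJ : row_base P *m K *m J = - (row_base P *m K).
  by rewrite -mulmxA -[K *m J]opprK -JK mulmxN mulmxA UJ.
have VK : row_base P *m K *m K = row_base P by rewrite -mulmxA KK mulmx1.
have free : row_free (col_mx (row_base P) (row_base P *m K)).
  apply: inj_row_free => w; rewrite -[w]hsubmxK mul_row_col => w0.
  have := congr1 (mulmxr J) w0; rewrite /= mul0mx mulmxDl -mulmxA UJ -mulmxA VJ mulmxN.
  move: w0; set a := _ *m row_base P; set b := _ *m (row_base P *m K) => ab0 amb0.
  have a0 : a = 0.
    apply/matrixP => i j; move/matrixP/(_ i j): ab0; move/matrixP/(_ i j): amb0.
    by rewrite !mxE; lra.
  have b0 : b = 0 by move: ab0; rewrite a0 add0r.
  have -> : lsubmx w = 0.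
    by apply: (row_free_inj (row_base_free P)); rewrite mul0mx.
  have -> : rsubmx w = 0.
    apply: (row_free_inj (row_base_free P)); rewrite mul0mx -VK.
    by rewrite mulmxA -/b b0 mul0mx.
  by rewrite row_mx0.
have full : row_full (col_mx (row_base P) (row_base P *m K)).
  rewrite -sub1mx -addsmxE.
  (* Conjugation by K turns P into the complementary projection. *)
  have -> : 1%:M = P + K *m P *m K.
    rewrite /P -scalemxAr -scalemxAl -scalerDr mulmxDr mulmxDl mulmx1 KK.
    rewrite -[K *m J]opprK -JK mulNmx -mulmxA KK mulmx1.
    by apply/matrixP => i j; rewrite !mxE; case: (i == j); lra.
  apply: addmx_sub_adds; first by rewrite eq_row_base.
  by apply: submxMr; rewrite eq_row_base submxMl.
split; last by split.
split=> //; exact: etrans (esym (eqP free)) (eqP full).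
Qed.

Lemma anticommuting_involutions_conjugate (R : realFieldType) (m : nat)
    (J K J' K' : 'M[R]_m) :
  J *m J = 1%:M -> K *m K = 1%:M -> J *m K = - (K *m J) ->
  J' *m J' = 1%:M -> K' *m K' = 1%:M -> J' *m K' = - (K' *m J') ->
  exists2 g, g \in unitmx & g *m J = J' *m g /\ g *m K = K' *m g.
Proof.
move=> JJ KK JK JJ' KK' JK'.
have [r [U [V [[rrm free UJ VJ] [UK VK]]]]] := anticommuting_involutions_basis JJ KK JK.
have [r' [U' [V' [[rrm' free' UJ' VJ'] [UK' VK']]]]] :=
  anticommuting_involutions_basis JJ' KK' JK'.
have rr : r = r' by rewrite -[r]half_double -[r']half_double -!addnn rrm rrm'.
subst r' m; clear rrm'.
rewrite !row_free_unit in free free'.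
exists (invmx (col_mx U' V') *m col_mx U V).
  by rewrite unitmx_mul unitmx_inv free' free.
have intertwines (M M' : 'M[R]_(r + r)) (D : 'M[R]_(r + r)) :
    col_mx U V *m M = D *m col_mx U V -> col_mx U' V' *m M' = D *m col_mx U' V' ->
    invmx (col_mx U' V') *m col_mx U V *m M = M' *m (invmx (col_mx U' V') *m col_mx U V).
  move=> E E'; rewrite -mulmxA E; apply: (can_inj (mulKmx free')).
  by rewrite !mulmxA mulmxV// mul1mx E' -!mulmxA mulKVmx.
split.
- apply: (intertwines _ _ (block_mx 1%:M 0 0 (- 1%:M))); rewrite mul_col_mx mul_block_col;
  by rewrite ?UJ ?VJ ?UJ' ?VJ' !mul0mx mul1mx mulNmx mul1mx addr0 add0r.
- apply: (intertwines _ _ (block_mx 0 1%:M 1%:M 0)); rewrite mul_col_mx mul_block_col;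
  by rewrite ?UK ?VK ?UK' ?VK' !mul0mx !mul1mx addr0 add0r.
Qed.

(** Gram-Schmidt: [A] and the normalisation of [B - x *: A] are anticommuting
    involutions, and [B] can be recovered from them. *)
Lemma involution_pairs_conjugate (R : rcfType) (m : nat) (A B A' B' : 'M[R]_m) (x : R) :
  x ^+ 2 < 1 ->
  A *m A = 1%:M -> B *m B = 1%:M -> A *m B + B *m A = (2 * x)%:M ->
  A' *m A' = 1%:M -> B' *m B' = 1%:M -> A' *m B' + B' *m A' = (2 * x)%:M ->
  exists2 g, g \in unitmx & g *m A = A' *m g /\ g *m B = B' *m g.
Proof.
move=> x1 AA BB AB AA' BB' AB'.
pose c := Num.sqrt (1 - x ^+ 2).
have c_gt0 : 0 < c by rewrite sqrtr_gt0 subr_gt0.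
have c0 : c != 0 by rewrite gt_eqF.
have cc : c * c = 1 - x ^+ 2 by rewrite -expr2 sqr_sqrtr// subr_ge0 ltW.
pose K (A B : 'M[R]_m) := c^-1 *: (B - x *: A).
have K_inv (S T : 'M[R]_m) : S *m S = 1%:M -> T *m T = 1%:M ->
    S *m T + T *m S = (2 * x)%:M -> K S T *m K S T = 1%:M.
  move=> SS TT ST; rewrite /K -scalemxAl -scalemxAr scalerA -invfM cc.
  have -> : (T - x *: S) *m (T - x *: S) = (1 - x ^+ 2) *: 1%:M.
    rewrite mulmxBl !mulmxBr -!scalemxAl -!scalemxAr TT SS.
    apply/matrixP => i j; move/matrixP/(_ i j): ST; rewrite !mxE.
    set p := \sum_j0 (S i j0 * T j0 j); set q := \sum_j0 (T i j0 * S j0 j).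
    by case: (i == j); nra.
  by rewrite scalerA mulVf ?scale1r// -cc mulf_neq0.
have K_anti (S T : 'M[R]_m) : S *m S = 1%:M ->
    S *m T + T *m S = (2 * x)%:M -> S *m K S T = - (K S T *m S).
  move=> SS ST; rewrite /K -scalemxAl -scalemxAr -[RHS]scalerN; congr (_ *: _).
  rewrite mulmxBl mulmxBr -!scalemxAl -!scalemxAr SS.
  apply/matrixP => i j; move/matrixP/(_ i j): ST; rewrite !mxE.
  by case: (i == j); lra.
have [g gu [gA gK]] := anticommuting_involutions_conjugate AA (K_inv _ _ AA BB AB)
   (K_anti _ _ AA AB) AA' (K_inv _ _ AA' BB' AB') (K_anti _ _ AA' AB').
exists g => //; split=> //.
have KE (S T : 'M[R]_m) : T = c *: K S T + x *: S.
  by rewrite /K scalerA mulfV// scale1r subrK.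
rewrite (KE A B) (KE A' B'); move: (K A B) (K A' B') gK => L L' gL.
by rewrite mulmxDr mulmxDl -!scalemxAl -!scalemxAr gL gA.
Qed.

(** * Clifford triples *)

(** A representation of the Clifford algebra of the quadratic form on a space
    with basis A, B, C whose Gram matrix has diagonal entries 1 and off-diagonal
    entries [x], [y], [z]. *)
Definition clifford_triple (R : pzRingType) (m : nat) (A B C : 'M[R]_m) (x y z : R) :=
  [/\ A *m A = 1%:M, B *m B = 1%:M & C *m C = 1%:M] /\
  [/\ A *m B + B *m A = (2 * x)%:M, B *m C + C *m B = (2 * y)%:M &
      A *m C + C *m A = (2 * z)%:M].

(** For a Clifford triple this is the antisymmetrised product (ABC - CBA)/2. *)
Definition pseudoscalar (R : pzRingType) (m : nat) (A B C : 'M[R]_m) (x y z : R) :=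
  A *m B *m C - (y *: A - z *: B + x *: C).

Section CliffordTriple.
Variables (R : realFieldType) (m : nat) (A B C : 'M[R]_m) (x y z : R).
Hypothesis ABC : clifford_triple A B C x y z.

Let AA : A *m A = 1%:M. Proof. by case: ABC => -[]. Qed.
Let BB : B *m B = 1%:M. Proof. by case: ABC => -[]. Qed.
Let CC : C *m C = 1%:M. Proof. by case: ABC => -[]. Qed.
Let BA : B *m A = (2 * x) *: 1%:M - A *m B.
Proof. by case: ABC => _ [E _ _]; rewrite scalemx1 -E addrC addKr. Qed.
Let CB : C *m B = (2 * y) *: 1%:M - B *m C.
Proof. by case: ABC => _ [_ E _]; rewrite scalemx1 -E addrC addKr. Qed.
Let CA : C *m A = (2 * z) *: 1%:M - A *m C.
Proof. by case: ABC => _ [_ _ E]; rewrite scalemx1 -E addrC addKr. Qed.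

Lemma clifford_reverse :
  C *m B *m A = 2 *: (y *: A - z *: B + x *: C) - A *m B *m C.
Proof.
rewrite CB mulmxBl -scalemxAl mul1mx -(mulmxA B) CA mulmxBr -scalemxAr mulmx1 mulmxA BA.
rewrite mulmxBl -scalemxAl mul1mx.
by move: (A *m B *m C) => W; apply/matrixP => i j; rewrite !mxE; ring.
Qed.

(** The pseudoscalar commutes with the generators, because the dimension of the
    quadratic space is odd. *)
Lemma pseudoscalar_central_A :
  A *m pseudoscalar A B C x y z = pseudoscalar A B C x y z *m A.
Proof.
rewrite /pseudoscalar mulmxBr mulmxBl !mulmxDr !mulmxDl !mulmxN !mulNmx.
rewrite -!scalemxAl -!scalemxAr.
rewrite !mulmxA AA mul1mx -(mulmxA (A *m B)) CA mulmxBr mulmxA -scalemxAr mulmx1.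
rewrite -(mulmxA A) BA mulmxBr -scalemxAr mulmx1 mulmxA AA mul1mx mulmxBl -scalemxAl.
move: (A *m B) (A *m C) (B *m C) => P Q S.
by apply/matrixP => i j; rewrite !mxE; ring.
Qed.

Lemma pseudoscalar_central_B :
  B *m pseudoscalar A B C x y z = pseudoscalar A B C x y z *m B.
Proof.
rewrite /pseudoscalar mulmxBr mulmxBl !mulmxDr !mulmxDl !mulmxN !mulNmx.
rewrite -!scalemxAl -!scalemxAr.
rewrite !mulmxA BB -(mulmxA (A *m B)) CB mulmxBr -scalemxAr mulmx1 !mulmxA.
rewrite -(mulmxA A B B) BB mulmx1 BA !mulmxBl -!scalemxAl.
rewrite -(mulmxA A B B) BB mulmx1 mul1mx.
move: (A *m B) (A *m C) (B *m C) => P Q S.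
by apply/matrixP => i j; rewrite !mxE; ring.
Qed.

Lemma pseudoscalar_central_C :
  C *m pseudoscalar A B C x y z = pseudoscalar A B C x y z *m C.
Proof.
pose v := y *: A - z *: B + x *: C.
(* Moving C to the left is easiest in the reversed word. *)
have -> : pseudoscalar A B C x y z = - (C *m B *m A) + v.
  rewrite clifford_reverse /pseudoscalar -/v.
  by apply/matrixP => i j; rewrite !mxE; ring.
rewrite mulmxDr mulmxDl mulmxN mulNmx.
rewrite !mulmxA CC mul1mx -(mulmxA (C *m B)).
have AC : A *m C = (2 * z) *: 1%:M - C *m A.
  by rewrite CA opprB addrC subrK.
have BC : B *m C = (2 * y) *: 1%:M - C *m B.
  by rewrite CB opprB addrC subrK.
rewrite /v !mulmxDr !mulmxDl !mulmxN !mulNmx -!scalemxAl -!scalemxAr CC AC BC.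
rewrite mulmxBr -scalemxAr mulmx1 mulmxA -(mulmxA C B C) BC mulmxBr mulmxA CC mul1mx.
rewrite -scalemxAr mulmx1 mulmxBl -scalemxAl.
move: (C *m A) (C *m B) (B *m A) => P Q S.
by apply/matrixP => i j; rewrite !mxE; ring.
Qed.

(** With v the vector part of ABC, ABC = h + v and CBA = v - h are inverse to each
    other and h commutes with v, so h^2 = v^2 - 1; the right-hand side is minus
    the determinant of the Gram matrix. *)
Lemma pseudoscalar_sqr :
  pseudoscalar A B C x y z *m pseudoscalar A B C x y z =
    (x ^+ 2 + y ^+ 2 + z ^+ 2 - 2 * x * y * z - 1)%:M.
Proof.
set h := pseudoscalar A B C x y z; pose v := y *: A - z *: B + x *: C.
have hv : h *m v = v *m h.
  have hA : A *m h = h *m A := pseudoscalar_central_A.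
  have hB : B *m h = h *m B := pseudoscalar_central_B.
  have hC : C *m h = h *m C := pseudoscalar_central_C.
  move: h hA hB hC => p pA pB pC.
  rewrite /v !mulmxDr !mulmxDl !mulmxN !mulNmx -!scalemxAl -!scalemxAr.
  by rewrite pA pB pC.
have E : (h + v) *m (v - h) = 1%:M.
  have -> : h + v = A *m B *m C by rewrite subrK.
  have -> : v - h = C *m B *m A.
    rewrite clifford_reverse /h /pseudoscalar -/v.
    by apply/matrixP => i j; rewrite !mxE; ring.
  by rewrite !mulmxA -(mulmxA (A *m B)) CC mulmx1 -(mulmxA A) BB mulmx1.
have vv : v *m v = (x ^+ 2 + y ^+ 2 + z ^+ 2 - 2 * x * y * z) *: 1%:M.
  rewrite /v !mulmxDr !mulmxDl !mulmxN !mulNmx -!scalemxAl -!scalemxAr.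
  rewrite AA BB CC CA CB BA; move: (A *m B) (A *m C) (B *m C) => P Q S.
  by apply/matrixP => i j; rewrite !mxE; ring.
have -> : h *m h = v *m v - 1%:M.
  move: hv E; clear vv; move: h v => p q pq; rewrite mulmxBr !mulmxDl pq => <-.
  by apply/matrixP => i j; rewrite !mxE; ring.
rewrite vv -[in RHS]scalemx1.
by apply/matrixP => i j; rewrite !mxE; ring.
Qed.

(** This expresses [C] through [A], [B] and the pseudoscalar when x^2 is not 1:
    the traceless part AB - x of AB has square x^2 - 1, and (AB - x) C is the
    pseudoscalar plus a combination of [A] and [B]. *)
Lemma clifford_third_generator :
  (x ^+ 2 - 1) *: C =
    (A *m B - x%:M) *m (pseudoscalar A B C x y z + y *: A - z *: B).
Proof.
have -> : pseudoscalar A B C x y z + y *: A - z *: B = (A *m B - x%:M) *m C.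
  rewrite mulmxBl mul_scalar_mx /pseudoscalar.
  by apply/matrixP => i j; rewrite !mxE; ring.
rewrite mulmxA.
have -> : (A *m B - x%:M) *m (A *m B - x%:M) = (x ^+ 2 - 1)%:M.
  rewrite mulmxBl mulmxBr mul_scalar_mx !mul_mx_scalar.
  have -> : A *m B *m (A *m B) = (2 * x) *: (A *m B) - 1%:M.
    rewrite !mulmxA -(mulmxA A) BA mulmxBr mulmxBl -scalemxAr mulmx1 -scalemxAl.
    by rewrite mulmxA AA mul1mx BB.
  rewrite scalerBr; move: (A *m B) => P.
  by apply/matrixP => i j; rewrite !mxE; case: (i == j); rewrite ?mulr1n ?mulr0n; ring.
by rewrite mul_scalar_mx.
Qed.

Lemma trace_product (S T : 'M[R]_m) (s : R) :
  S *m T + T *m S = (2 * s)%:M -> \tr (S *m T) = m%:R * s.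
Proof.
move=> /(congr1 mxtrace); rewrite mxtraceD (mxtrace_mulC T) mxtrace_scalar -mulr_natl.
lra.
Qed.

(** The square of this trace contains the product xyz, and so detects the sign
    that the squares of [x], [y], [z] leave open. *)
Lemma trace_ABAC : \tr (A *m B *m (A *m C)) = m%:R * (2 * x * z - y).
Proof.
have [_ [_ BCE ACE]] := ABC.
rewrite !mulmxA -(mulmxA A) BA mulmxBr mulmxA AA mul1mx mulmxBl -scalemxAr mulmx1.
rewrite -scalemxAl raddfB/= mxtraceZ (trace_product BCE) (trace_product ACE).
by ring.
Qed.

End CliffordTriple.

(** Changing the signs of three vectors changes the signs of their inner products
    in all ways that preserve the product xyz.  If one of them is zero, its sign
    is free and the product imposes no condition. *)
Lemma normalize_signs (R : realFieldType) (x y z x0 y0 z0 : R) :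
  x ^+ 2 = x0 ^+ 2 -> y ^+ 2 = y0 ^+ 2 -> z ^+ 2 = z0 ^+ 2 -> x * y * z = x0 * y0 * z0 ->
  exists r s u : R, [/\ r ^+ 2 = 1, s ^+ 2 = 1 & u ^+ 2 = 1] /\
    [/\ r * s * x = x0, s * u * y = y0 & r * u * z = z0].
Proof.
have sign (v v0 : R) : v ^+ 2 = v0 ^+ 2 -> exists2 e, e ^+ 2 = 1 & e * v = v0.
  move/eqP; rewrite eqf_sqr => /orP[/eqP->|/eqP->].
    by exists 1; rewrite ?expr1n ?mul1r.
  by exists (-1); rewrite ?sqrrN ?expr1n ?mulrN1 ?opprK// mulN1r opprK.
move=> /sign[e1 s1 <-] /sign[e2 s2 <-] /sign[e3 s3 <-] P.
have [x0'|xn] := eqVneq x 0.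
  exists e3, e2, 1; rewrite expr1n; split=> //; rewrite !mulr1 x0' !mulr0; split=> //.
have [y0'|yn] := eqVneq y 0.
  exists e3, (e3 * e1), 1; rewrite expr1n !mulr1 y0' !mulr0 exprMn s3 s1 mulr1; split=> //.
  by rewrite mulrA -expr2 s3 mul1r.
have [z0'|zn] := eqVneq z 0.
  exists e1, 1, e2; rewrite expr1n !mulr1 !mul1r z0' !mulr0; split=> //.
have xyz0 : x * y * z != 0 by rewrite !mulf_neq0.
have e123 : e1 * e2 * e3 = 1.
  by apply: (mulIf xyz0); rewrite mul1r [RHS]P; ring.
exists e1, 1, e2; rewrite expr1n !mulr1 !mul1r; split=> //; split=> //; congr (_ * _).
by rewrite -[RHS]mul1r -e123 -mulrA -expr2 s3 mulr1.
Qed.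

Lemma clifford_triple_signs (R : realFieldType) (m : nat) (A B C : 'M[R]_m)
    (x y z r s u : R) :
  r ^+ 2 = 1 -> s ^+ 2 = 1 -> u ^+ 2 = 1 -> clifford_triple A B C x y z ->
  clifford_triple (r *: A) (s *: B) (u *: C) (r * s * x) (s * u * y) (r * u * z).
Proof.
move=> r1 s1 u1 [[AA BB CC] [AB BC AC]].
split; split; rewrite -!scalemxAl -!scalemxAr !scalerA -?expr2 ?r1 ?s1 ?u1 ?scale1r//.
- by rewrite [s * r]mulrC -scalerDr AB scale_scalar_mx; congr (_%:M); ring.
- by rewrite [u * s]mulrC -scalerDr BC scale_scalar_mx; congr (_%:M); ring.
- by rewrite [u * r]mulrC -scalerDr AC scale_scalar_mx; congr (_%:M); ring.
Qed.

Lemma pseudoscalar_sign (R : realFieldType) (m : nat) (A B C : 'M[R]_m) (x y z s : R) :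
  s ^+ 2 = 1 ->
  pseudoscalar (s *: A) (s *: B) (s *: C) x y z = s *: pseudoscalar A B C x y z.
Proof.
move=> s1; rewrite /pseudoscalar -!scalemxAl -!scalemxAr -scalemxAl !scalerA.
rewrite mulrA -expr2 s1 mul1r.
by rewrite scalerBr scalerDr scalerBr !scalerA ![s * _]mulrC.
Qed.

(** A matrix that conjugates one pair [A], [B] into the other also conjugates the
    third generators, which are given by the same formula in the pair. *)
Lemma clifford_triples_conjugate (R : rcfType) (m : nat)
    (A B C A' B' C' : 'M[R]_m) (x y z e : R) :
  x ^+ 2 < 1 ->
  clifford_triple A B C x y z -> clifford_triple A' B' C' x y z ->
  pseudoscalar A B C x y z = e%:M -> pseudoscalar A' B' C' x y z = e%:M ->
  exists2 g, g \in unitmx &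
    [/\ g *m A = A' *m g, g *m B = B' *m g & g *m C = C' *m g].
Proof.
move=> x1 T T' he he'.
have [[AA BB _] [AB _ _]] := T; have [[AA' BB' _] [AB' _ _]] := T'.
have [g gu [gA gB]] := involution_pairs_conjugate x1 AA BB AB AA' BB' AB'.
exists g => //; split=> //.
have x10 : x ^+ 2 - 1 != 0 by rewrite lt_eqF// subr_lt0.
have := clifford_third_generator T; have := clifford_third_generator T'.
rewrite he he' => E' E; apply: (scalerI x10).
rewrite scalemxAr scalemxAl E E'.
have -> : g *m ((A *m B - x%:M) *m (e%:M + y *: A - z *: B)) =
    (A' *m B' - x%:M) *m (g *m (e%:M + y *: A - z *: B)).
  rewrite !mulmxA; congr (_ *m _).
  by rewrite mulmxBr mulmxBl mulmxA gA -!mulmxA gB scalar_mxC.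
rewrite -!mulmxA; congr (_ *m _).
rewrite mulmxBr mulmxBl mulmxDr mulmxDl -!scalemxAl -!scalemxAr gA gB.
by rewrite scalar_mxC.
Qed.

(** * Reflections of the hyperbolic plane *)

Section Reflections.
Variable R : realType.
Implicit Types (p q z w : R[i]) (M : 'M[R]_2).

(** For trace-zero [M] of negative determinant, the zero set of this form in the
    upper half-plane is the geodesic that [M] fixes pointwise; for fixed [p] it is
    a linear form on matrices. *)
Definition geodesic_form M p : R :=
  M 0 1 + 2 * complex.Re p * M 0 0 - (complex.Re p ^+ 2 + complex.Im p ^+ 2) * M 1 0.

Lemma det_mx22 M : \det M = M 0 0 * M 1 1 - M 0 1 * M 1 0.
Proof.
rewrite (expand_det_row _ 0) !big_ord_recl big_ord0 addr0 /cofactor !det_mx11 !mxE /=.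
rewrite expr0 expr1 mul1r mulN1r mulrN.
by congr (_ * M _ _ - M _ _ * M _ _); apply/val_inj.
Qed.

(** The denominator cannot be zero, since then the quotient would be 0, which is
    not in the upper half-plane. *)
Lemma fixed_point_equation (p n d : R[i]) :
  upper_half_plane p -> n / d = p -> n = p * d.
Proof.
move=> hp E; have p0 : p != 0.
  by apply: contraTneq hp => ->; rewrite /upper_half_plane /= ltxx.
rewrite -E divfK//; apply: contra_neq p0 => d0.
by rewrite -E d0 invr0 mulr0.
Qed.

(** A holomorphic Moebius map fixes [p] and its conjugate, and a quadratic equation
    is determined up to a factor by its two roots. *)
Lemma moebius_mx_fixed_direct M p : upper_half_plane p -> 0 < \det M ->
  moebius_mx M p = p ->
  M 0 0 = 2 * M 1 0 * complex.Re p + M 1 1 /\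
  M 0 1 = - M 1 0 * (complex.Re p ^+ 2 + complex.Im p ^+ 2).
Proof.
case: p => u v hp dM; rewrite /moebius_mx dM => /(fixed_point_equation hp).
have v0 : 0 < v := hp; simpc => -[E1 E2].
have E3 : M 0 0 = 2 * M 1 0 * u + M 1 1.
  by apply: (mulIf (lt0r_neq0 v0)); lra.
by split=> //=; move: E1; rewrite E3; lra.
Qed.

Lemma moebius_mx_fixed_reverse M p : upper_half_plane p -> \det M < 0 ->
  moebius_mx M p = p ->
  M 1 1 = - M 0 0 /\ geodesic_form M p = 0.
Proof.
case: p => u v hp dM; rewrite /moebius_mx /geodesic_form ltNge (ltW dM)/=.
move=> /(fixed_point_equation hp); have v0 : 0 < v := hp; simpc => -[E1 E2].
have E3 : M 1 1 = - M 0 0.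
  by apply: (mulIf (lt0r_neq0 v0)); lra.
split=> //; move: E1; rewrite E3 => /eqP; rewrite -subr_eq0 => /eqP <-.
by ring.
Qed.

Lemma hdist_id z : upper_half_plane z -> hdist z z = 0.
Proof.
move=> z0; rewrite /hdist !subrr expr0n/= addr0 mul0r addr0 /arcosh.
by rewrite expr1n subrr sqrtr0 addr0 ln1.
Qed.

Lemma side_left p q : upper_half_plane p -> side p q p.
Proof. by move=> hp; split=> //; rewrite hdist_id// add0r. Qed.

Lemma side_right p q : upper_half_plane q -> side p q q.
Proof. by move=> hp; split=> //; rewrite hdist_id// addr0. Qed.

(** An isometry that preserves orientation and fixes two points is trivial, so [g]
    reverses orientation; its matrix is scaled to have determinant -1. *)
Lemma reflection_lift (g : PGL R 2) p q :
  upper_half_plane p -> upper_half_plane q -> p <> q -> is_reflection g p q ->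
  exists2 A : GL R 2, g = \pi_(PGL R 2) A &
    [/\ val A 1 1 = - val A 0 0, val A 0 0 ^+ 2 + val A 0 1 * val A 1 0 = 1,
        geodesic_form (val A) p = 0 & geodesic_form (val A) q = 0].
Proof.
move=> hp hq pq [g1 gfix].
have gp := gfix p (side_left q hp); have gq := gfix q (side_right p hq).
rewrite /moebius in gp gq; move: (erefl (repr g)) gp gq.
case: {2}(repr g) => M Mu Eg; rewrite Eg /= => gp gq.
have Egg : g = \pi_(PGL R 2) (repr g) by rewrite reprK.
have : \det M != 0 by rewrite -unitfE -unitmxE.
rewrite neq_lt => /orP[dM|dM]; last first.
  have [p1 p2] := moebius_mx_fixed_direct hp dM gp.
  have [q1 q2] := moebius_mx_fixed_direct hq dM gq.
  (* Otherwise the fixed points p and q have the same real part and modulus. *)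
  have c0 : M 1 0 = 0.
    apply/eqP/negPn/negP => c0; apply: pq.
    move: p q hp hq p1 p2 q1 q2 {gfix gp gq} => [u v] [u' v'] /= v0 v0' p1 p2 q1 q2.
    have uu : u = u'.
      apply: (mulfI c0); have := etrans (esym p1) q1; lra.
    have vv : v ^+ 2 = v' ^+ 2.
      apply: (mulfI c0); have := etrans (esym p2) q2; rewrite uu; lra.
    rewrite uu; congr (_ +i* _)%C; apply/eqP.
    by rewrite -(@eqrXn2 _ 2) ?vv//; exact: ltW.
  case: g1; rewrite Egg Eg; apply/pi_PGL; exists (M 1 1).
    apply: contraTneq dM => d0; rewrite det_mx22 p1 c0 d0.
    by rewrite mulr0 mulr0 subrr ltxx.
  apply/matrixP => i j; rewrite /= !mxE.
  rewrite c0 oppr0 mul0r in p2; rewrite c0 mulr0 mul0r add0r in p1.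
  by case: i j => [[|[|//]] ?] [[|[|//]] ?]; rewrite /= ?mulr1 ?mulr0;
    [rewrite -[RHS]p1|rewrite -[RHS]p2|rewrite -[RHS]c0|]; congr (M _ _); apply/val_inj.
have [p1 p2] := moebius_mx_fixed_reverse hp dM gp.
have [_ q2] := moebius_mx_fixed_reverse hq dM gq.
pose s := Num.sqrt (- \det M).
have s_gt0 : 0 < s by rewrite sqrtr_gt0 oppr_gt0.
have s0 : s != 0 by rewrite gt_eqF.
have ss : s ^+ 2 = M 0 0 ^+ 2 + M 0 1 * M 1 0.
  rewrite sqr_sqrtr ?oppr_ge0 ?ltW// det_mx22 p1; ring.
have Au : s^-1 *: M \in unitmx.
  by rewrite unitmxE detZ unitfE mulf_neq0 ?expf_neq0 ?invr_eq0// lt_eqF.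
exists (exist (fun B => B \in unitmx) _ Au).
  by rewrite Egg Eg; apply/pi_PGL; exists s => //=; rewrite scalerA mulfV// scale1r.
have form_scale z : geodesic_form M z = 0 -> geodesic_form (s^-1 *: M) z = 0.
  rewrite /geodesic_form !mxE => h.
  transitivity (s^-1 * 0); last by rewrite mulr0.
  by rewrite -h; ring.
split; rewrite /= ?mxE ?p1 ?mulrN//; try exact: form_scale.
rewrite exprMn [X in _ + X]mulrACA -(expr2 s^-1) -mulrDr -ss exprVn mulVf//.
by rewrite expf_neq0.
Qed.

(** The hyperbolic cosine of ln u - ln w is half of u/w + w/u. *)
Lemma arcosh_half_sum (u w : R) : 0 < u -> 0 < w ->
  arcosh ((u / w + w / u) / 2) = `|ln u - ln w|.
Proof.
wlog uw : u w / w <= u.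
  move=> H u0 w0; have [h|h] := lerP w u; first exact: H.
  by rewrite addrC distrC; apply: H => //; exact: ltW.
move=> u0 w0; rewrite -ln_div ?posrE//.
have t1 : 1 <= u / w by rewrite ler_pdivlMr// mul1r.
have t0 : 0 < u / w by apply: lt_le_trans t1.
rewrite ger0_norm; last exact: ln_ge0.
have -> : w / u = (u / w)^-1 by rewrite invf_div.
move: (u / w) t0 t1 => t t0 t1; congr ln.
have tt : t * t^-1 = 1 by rewrite mulfV// gt_eqF.
have t1' : t^-1 <= t by rewrite (le_trans _ t1)// invf_le1.
have -> : ((t + t^-1) / 2) ^+ 2 - 1 = ((t - t^-1) / 2) ^+ 2.
  by rewrite -[1]tt; field; rewrite gt_eqF.
rewrite sqrtr_sqr ger0_norm; first by lra.
by rewrite divr_ge0// subr_ge0.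
Qed.

(** Arc length parameters: ln(Im z) on a vertical line, and on a half-circle
    ln(tan(theta/2)), theta being the angle at its centre. *)
Lemma geodesic_parameter M : M 1 1 = - M 0 0 ->
  M 0 0 ^+ 2 + M 0 1 * M 1 0 = 1 ->
  exists f : R[i] -> R, forall z w,
    upper_half_plane z -> upper_half_plane w ->
    geodesic_form M z = 0 -> geodesic_form M w = 0 -> hdist z w = `|f z - f w|.
Proof.
move=> M11 M1; rewrite /geodesic_form.
move: (M 0 0) (M 0 1) (M 1 0) M1 => a b c {M M11} M1.
have [c0|c0] := eqVneq c 0.
  exists (fun z => ln (complex.Im z)) => -[u v] [u' v'] /= v0 v0' e e'.
  rewrite /hdist /= -arcosh_half_sum//; congr arcosh.
  rewrite c0 !mulr0 !subr0 ?addr0 in M1 e e'.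
  have a0 : a != 0 by apply: contra_eq_neq M1 => ->; rewrite expr0n/= eq_sym oner_eq0.
  have -> : u = u' by apply: (mulIf a0); lra.
  by field; rewrite !gt_eqF.
(* (X z, Y z) is the point z in the unit circle obtained by translating the
   centre a/c to 0 and dividing by the radius 1/|c|, up to reflection in the
   vertical axis; tan(theta/2) is Y / (1 + X). *)
pose X z : R := c * complex.Re z - a; pose Y z : R := `|c| * complex.Im z.
exists (fun z => ln (Y z / (1 + X z))).
have Ygt0 z : upper_half_plane z -> 0 < Y z.
  by move=> z0; rewrite mulr_gt0// normr_gt0.
have circle z :
    b + 2 * complex.Re z * a - (complex.Re z ^+ 2 + complex.Im z ^+ 2) * c = 0 ->
    X z ^+ 2 + Y z ^+ 2 = 1.
  move=> e; rewrite /X /Y [(_ * _) ^+ 2]exprMn real_normK ?num_real//.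
  rewrite -M1; apply/eqP; rewrite -subr_eq0; apply/eqP.
  transitivity (- c * 0); last by rewrite mulr0.
  by rewrite -e; ring.
move=> z w hz hw /circle ez /circle ew.
have := Ygt0 _ hz; have := Ygt0 _ hw => Yw Yz.
have Xz : 0 < 1 + X z by nra.
have Xw : 0 < 1 + X w by nra.
rewrite -arcosh_half_sum ?divr_gt0//; rewrite /hdist; congr arcosh.
have nc0 : `|c| != 0 by rewrite normr_eq0.
have -> : ((complex.Re z - complex.Re w) ^+ 2 + (complex.Im z - complex.Im w) ^+ 2) /
    (2 * complex.Im z * complex.Im w) =
    ((X z - X w) ^+ 2 + (Y z - Y w) ^+ 2) / (2 * Y z * Y w).
  have -> : (X z - X w) ^+ 2 + (Y z - Y w) ^+ 2 =
      `|c| ^+ 2 *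
      ((complex.Re z - complex.Re w) ^+ 2 + (complex.Im z - complex.Im w) ^+ 2).
    transitivity (c ^+ 2 * (complex.Re z - complex.Re w) ^+ 2 +
        `|c| ^+ 2 * (complex.Im z - complex.Im w) ^+ 2); first by rewrite /X /Y; ring.
    by rewrite -[c ^+ 2]real_normK ?num_real// -mulrDr.
  rewrite /Y; field.
  by rewrite nc0 !gt_eqF.
move: (X z) (X w) (Y z) (Y w) ez ew Yw Yz Xz Xw => x x' y y' e e' y0' y0 x0 x0'.
have quotient (x1 x2 y1 y2 : R) : x1 ^+ 2 + y1 ^+ 2 = 1 ->
    0 < y1 -> 0 < y2 -> 0 < 1 + x1 -> 0 < 1 + x2 ->
    y1 / (1 + x1) / (y2 / (1 + x2)) = (1 - x1) * (1 + x2) / (y1 * y2).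
  move=> e1 y10 y20 x10 x20; rewrite invf_div mulf_div.
  apply/eqP; rewrite eqr_div ?mulf_neq0 ?lt0r_neq0//; apply/eqP.
  apply: subr0_eq.
  transitivity ((x1 ^+ 2 + y1 ^+ 2 - 1) * ((1 + x2) * y2)); first by ring.
  by rewrite e1 subrr mul0r.
rewrite !quotient// (mulrC y' y) -mulrDl.
have -> : (x - x') ^+ 2 + (y - y') ^+ 2 = 2 * (1 - x * x') - 2 * (y * y').
  have -> : (x - x') ^+ 2 + (y - y') ^+ 2 =
     (x ^+ 2 + y ^+ 2) + (x' ^+ 2 + y' ^+ 2) - 2 * (x * x') - 2 * (y * y') by ring.
  by rewrite e e'; ring.
by field; rewrite !gt_eqF.
Qed.

Lemma hyperbolic_triangle_neq p q r : hyperbolic_triangle p q r ->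
  [/\ p <> q, q <> r & p <> r].
Proof.
move=> [[hp hq hr] [n1 n2 n3]].
by split=> E; [apply: n2; rewrite E; exact: side_left|
  apply: n3; rewrite E; exact: side_right|
  apply: n1; rewrite E; exact: side_right].
Qed.

Lemma hdistC z w : hdist z w = hdist w z.
Proof.
rewrite /hdist; congr (arcosh (1 + _)).
by congr (_ / _); [congr (_ + _); rewrite -sqrrN opprB|rewrite mulrAC].
Qed.

Lemma sideC p q z : side p q z -> side q p z.
Proof.
by move=> [hz e]; split=> //; rewrite addrC [hdist z p]hdistC [hdist q z]hdistC e hdistC.
Qed.

Lemma hyperbolic_triangle_swap p q r : hyperbolic_triangle p q r ->
  hyperbolic_triangle p r q.
Proof.
move=> [[hp hq hr] [n1 n2 n3]]; split; split=> //.
by move=> /sideC.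
Qed.

Lemma hyperbolic_triangle_rotate p q r : hyperbolic_triangle p q r ->
  hyperbolic_triangle q r p.
Proof. by move=> [[hp hq hr] [n1 n2 n3]]; split; split=> // /sideC. Qed.

(** Of three points on a line, one lies between the other two, and then the two
    distances add up. *)
Lemma no_common_geodesic M p q r : hyperbolic_triangle p q r ->
  M 1 1 = - M 0 0 -> M 0 0 ^+ 2 + M 0 1 * M 1 0 = 1 ->
  geodesic_form M p = 0 -> geodesic_form M q = 0 -> geodesic_form M r <> 0.
Proof.
move=> [[hp hq hr] [n1 n2 n3]] M11 M1 ep eq er.
have [f fE] := geodesic_parameter M11 M1.
have pq := fE _ _ hp hq ep eq; have qr := fE _ _ hq hr eq er.
have pr := fE _ _ hp hr ep er.
have qp := fE _ _ hq hp eq ep; have rq := fE _ _ hr hq er eq.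
have : [\/ hdist q p + hdist p r = hdist q r, hdist p r + hdist r q = hdist p q |
            hdist p q + hdist q r = hdist p r].
  rewrite pq qr pr qp rq.
  move: (f p) (f q) (f r) => a b c.
  have [h1|h1] := lerP a b; have [h2|h2] := lerP b c; have [h3|h3] := lerP a c.
  all: try solve [constructor 1; lra|constructor 2; lra|constructor 3; lra].
by case=> h; [apply: n1|apply: n3|apply: n2].
Qed.

End Reflections.

(** * Linear independence of the reflections *)

Section Pencil.
Variable R : realFieldType.

(** A strict Cauchy-Schwarz inequality: on the trace-zero matrices
    [[a, b], [c, -a]] fixing the point u + iv, the form a^2 + bc is the sum of the
    squares of a - uc and vc, hence positive definite.  The two matrices are not
    proportional, since a linear form separates them. *)
Lemma polar_sqr_lt1 (a b c a' b' c' u v k l : R) : v != 0 ->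
  b + 2 * u * a - (u ^+ 2 + v ^+ 2) * c = 0 ->
  b' + 2 * u * a' - (u ^+ 2 + v ^+ 2) * c' = 0 ->
  a ^+ 2 + b * c = 1 -> a' ^+ 2 + b' * c' = 1 ->
  b' + k * a' - l * c' = 0 -> b + k * a - l * c != 0 ->
  (a * a' + (b * c' + b' * c) / 2) ^+ 2 < 1.
Proof.
move=> v0 e e' Q Q' h' h.
have eb : b = (u ^+ 2 + v ^+ 2) * c - 2 * u * a by lra.
have eb' : b' = (u ^+ 2 + v ^+ 2) * c' - 2 * u * a' by lra.
have -> : (a * a' + (b * c' + b' * c) / 2) ^+ 2 = 1 - (v * (a * c' - c * a')) ^+ 2.
  have QQ : 1 = (a ^+ 2 + b * c) * (a' ^+ 2 + b' * c') by rewrite Q Q' mulr1.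
  rewrite [X in _ = X - _]QQ.
  by rewrite eb eb'; field.
rewrite ltrBlDr ltrDl lt0r sqr_ge0 andbT sqrf_eq0 mulf_neq0//.
apply: contra h; rewrite subr_eq0 => /eqP D.
have ha : a' * (b + k * a - l * c) = a * (b' + k * a' - l * c').
  apply: subr0_eq.
  transitivity ((u ^+ 2 + v ^+ 2 - l) * (a' * c - a * c')); first by rewrite eb eb'; ring.
  by rewrite D mulrC (mulrC c) subrr mul0r.
have hc : c' * (b + k * a - l * c) = c * (b' + k * a' - l * c').
  apply: subr0_eq.
  transitivity ((k - 2 * u) * (a * c' - c * a')); first by rewrite eb eb'; ring.
  by rewrite D subrr mulr0.
rewrite h' !mulr0 in ha hc.
move/eqP: ha; rewrite mulf_eq0 => /orP[/eqP a'0|//].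
move/eqP: hc; rewrite mulf_eq0 => /orP[/eqP c'0|//].
by move/eqP: Q'; rewrite a'0 c'0 expr0n/= mulr0 addr0 eq_sym oner_eq0.
Qed.

(** Three vectors on which three linear forms take a diagonal matrix of values,
    with non-zero diagonal entries, have a non-zero determinant. *)
Lemma det3_diagonal_forms_neq0 (a b c a' b' c' a'' b'' c'' k l k' l' k'' l'' : R) :
  b' + k * a' - l * c' = 0 -> b'' + k * a'' - l * c'' = 0 ->
  b + k' * a - l' * c = 0 -> b'' + k' * a'' - l' * c'' = 0 ->
  b + k'' * a - l'' * c = 0 -> b' + k'' * a' - l'' * c' = 0 ->
  b + k * a - l * c != 0 -> b' + k' * a' - l' * c' != 0 ->
  b'' + k'' * a'' - l'' * c'' != 0 ->
  a * (b' * c'' - b'' * c') - b * (a' * c'' - a'' * c') + c * (a' * b'' - a'' * b') != 0.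
Proof.
move=> e1 e2 e3 e4 e5 e6 n1 n2 n3; apply/eqP => D.
have := mulf_neq0 (mulf_neq0 n1 n2) n3 => /eqP; apply.
set L11 := b + _ - _ in n1 *; set L22 := b' + _ - _ in n2 *.
set L33 := b'' + _ - _ in n3 *.
(* The determinant of the matrix of values is the product of its diagonal, and
   is also the determinant of the forms times that of the vectors. *)
transitivity (
  L11 * (L22 * L33 - (b'' + k' * a'' - l' * c'') * (b' + k'' * a' - l'' * c'))
  - (b' + k * a' - l * c') * ((b + k' * a - l' * c) * L33 -
      (b'' + k' * a'' - l' * c'') * (b + k'' * a - l'' * c))
  + (b'' + k * a'' - l * c'') * ((b + k' * a - l' * c) * (b' + k'' * a' - l'' * c') -
      L22 * (b + k'' * a - l'' * c))).
  by rewrite e1 e2 e3 e4 e5 e6; ring.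
transitivity ((k * (l' - l'') - l * (k' - k'') + (k' * l'' - k'' * l')) *
  (a * (b' * c'' - b'' * c') - b * (a' * c'' - a'' * c') + c * (a' * b'' - a'' * b'))).
  by rewrite /L11 /L22 /L33; ring.
by rewrite D mulr0.
Qed.

End Pencil.

(** * The diagonal image of the geometric representation *)

Lemma mx22E (R : Type) (M N : 'M[R]_2) :
  M 0 0 = N 0 0 -> M 0 1 = N 0 1 -> M 1 0 = N 1 0 -> M 1 1 = N 1 1 -> M = N.
Proof.
move=> h00 h01 h10 h11; apply/matrixP => i j.
have [->|->] : i = 0 \/ i = 1 by case: i => -[|[|//]] ?; [left|right]; apply/val_inj.
all: have [->|->] // : j = 0 \/ j = 1 by case: j => -[|[|//]] ?; [left|right]; apply/val_inj.
Qed.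


Lemma mulmx22 (R : pzSemiRingType) (M N : 'M[R]_2) i j :
  (M *m N) i j = M i 0 * N 0 j + M i 1 * N 1 j.
Proof.
rewrite mxE big_ord_recl big_ord1; congr (_ + M _ _ * N _ _); exact/val_inj.
Qed.

Section Traceless.
Variable R : realFieldType.
Implicit Types (A B C : 'M[R]_2).

(** Polarisation of the fact that the square of a trace-zero matrix is minus its
    determinant. *)
Lemma traceless_anticommutator A B : A 1 1 = - A 0 0 -> B 1 1 = - B 0 0 ->
  A *m B + B *m A =
    (2 * (A 0 0 * B 0 0 + (A 0 1 * B 1 0 + B 0 1 * A 1 0) / 2))%:M.
Proof.
move=> hA hB; apply: mx22E; rewrite !(mulmx22, mxE) /=.
all: rewrite ?hA ?hB ?mulr1n ?mulr0n; by field.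
Qed.

Lemma traceless_sqr A : A 1 1 = - A 0 0 ->
  A *m A = (A 0 0 ^+ 2 + A 0 1 * A 1 0)%:M.
Proof.
move=> hA; apply: mx22E; rewrite !(mulmx22, mxE) /=.
all: rewrite ?hA ?mulr1n ?mulr0n; by ring.
Qed.

(** In the plane the pseudoscalar is a scalar, and it is half of the determinant of
    the coordinates of the three matrices: it vanishes exactly when they are
    linearly dependent. *)
Lemma traceless_pseudoscalar A B C (x y z : R) :
  A 1 1 = - A 0 0 -> B 1 1 = - B 0 0 -> C 1 1 = - C 0 0 ->
  clifford_triple A B C x y z ->
  pseudoscalar A B C x y z =
    ((A 0 0 * (B 0 1 * C 1 0 - C 0 1 * B 1 0) - A 0 1 * (B 0 0 * C 1 0 - C 0 0 * B 1 0)
      + A 1 0 * (B 0 0 * C 0 1 - C 0 0 * B 0 1)) / 2)%:M.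
Proof.
move=> hA hB hC [_ [AB BC AC]].
have polarE (M N : 'M[R]_2) s : M 1 1 = - M 0 0 -> N 1 1 = - N 0 0 ->
    M *m N + N *m M = (2 * s)%:M ->
    s = M 0 0 * N 0 0 + (M 0 1 * N 1 0 + N 0 1 * M 1 0) / 2.
  move=> hM hN; rewrite traceless_anticommutator// => /matrixP/(_ 0 0).
  by rewrite !(mulmx22, mxE) /= !mulr1n; lra.
rewrite (polarE _ _ _ hA hB AB) (polarE _ _ _ hB hC BC) (polarE _ _ _ hA hC AC).
rewrite /pseudoscalar.
apply: mx22E; rewrite !(mulmx22, mxE) /=.
all: rewrite ?hA ?hB ?hC ?mulr1n ?mulr0n; by field.
Qed.

End Traceless.

Section Diagonal.
Variables (R : realType) (n : nat).
Implicit Types (A B C : 'M[R]_2).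

Definition diagonal_mx A : 'M[R]_(n * 2) := (1%:M : 'M[R]_n) *t A.
Local Notation D := diagonal_mx.

Lemma diagonalM A B : D A *m D B = D (A *m B).
Proof. by rewrite /diagonal_mx tensmx_mul mul1mx. Qed.

Lemma diagonalD A B : D (A + B) = D A + D B.
Proof. by apply/matrixP => i j; rewrite !mxE mulrDr. Qed.

Lemma diagonalB A B : D (A - B) = D A - D B.
Proof. by apply/matrixP => i j; rewrite !mxE mulrBr. Qed.

Lemma diagonalZ (c : R) A : D (c *: A) = c *: D A.
Proof. by apply/matrixP => i j; rewrite !mxE mulrCA. Qed.

Lemma diagonal_scalar (c : R) : D c%:M = c%:M.
Proof. by rewrite -scalemx1 diagonalZ /diagonal_mx tensmx11 scalemx1. Qed.

Lemma diagonal_clifford_triple A B C x y z :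
  clifford_triple A B C x y z -> clifford_triple (D A) (D B) (D C) x y z.
Proof.
move=> [[AA BB CC] [AB BC AC]].
by split; split; rewrite !diagonalM -?diagonalD ?AA ?BB ?CC ?AB ?BC ?AC diagonal_scalar.
Qed.

Lemma diagonal_pseudoscalar A B C x y z e :
  pseudoscalar A B C x y z = e%:M ->
  pseudoscalar (D A) (D B) (D C) x y z = e%:M.
Proof.
rewrite -diagonal_scalar => <-.
by rewrite /pseudoscalar !diagonalM !(diagonalB, diagonalD, diagonalZ).
Qed.

Lemma diagonal_trace A : \tr (D A) = n%:R * \tr A.
Proof.
rewrite /mxtrace; under eq_bigr do rewrite mxE.
rewrite -(mulr_sum (fun i => (1%:M : 'M[R]_n) i i) (fun i => A i i)).
congr (_ * _); under eq_bigr do rewrite mxE eqxx.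
by rewrite sumr_const card_ord.
Qed.

Lemma diagonal_unimodular_lift (A : GL R 2) : (0 < n)%N ->
  val A *m val A = 1%:M ->
  unimodular_lift (diag_rep n (\pi_(PGL R 2) A)) (D (val A)).
Proof.
move=> n0 AA; exists (diag_GL n A); first by rewrite diag_rep_pi.
have : \det (D (val A)) ^+ 2 = 1.
  by rewrite expr2 -det_mulmx diagonalM AA diagonal_scalar det1.
move=> d1; apply/eqP; rewrite -(@pexpr_eq1 _ _ 2)// -normrX d1 normr1//.
Qed.

End Diagonal.

(** Each reflection is in the kernels of the forms of the two vertices on its side
    and not in that of the opposite one.  This makes the matrix of values of
    [det3_diagonal_forms_neq0] diagonal, and separates the first two reflections,
    which both fix the first vertex. *)
Lemma geometric_clifford_triple (R : realType) (n k1 k2 k3 : nat)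
    (rho_geom : {multiplicative triangle_group k1 k2 k3 -> PGL R 2}) :
  (0 < n)%N -> geometric_rep rho_geom ->
  exists (A B C : 'M[R]_(n * 2)) (x y z e : R),
    [/\ unimodular_lift (diag_rep n (rho_geom (tri_a k1 k2 k3))) A,
        unimodular_lift (diag_rep n (rho_geom (tri_b k1 k2 k3))) B &
        unimodular_lift (diag_rep n (rho_geom (tri_c k1 k2 k3))) C] /\
    [/\ \tr A = 0, \tr B = 0 & \tr C = 0] /\
    [/\ clifford_triple A B C x y z, pseudoscalar A B C x y z = e%:M, e != 0 &
        x ^+ 2 < 1].
Proof.
move=> n0 [p [q [r [tri _ [ra rb rc]]]]].
have [[hp hq hr] _] := tri.
have [pq qr pr] := hyperbolic_triangle_neq tri.
have [A -> [A11 A1 Ap Ar]] := reflection_lift hp hr pr ra.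
have [B -> [B11 B1 Bp Bq]] := reflection_lift hp hq pq rb.
have [C -> [C11 C1 Cq Cr]] := reflection_lift hq hr qr rc.
have nAq := no_common_geodesic (hyperbolic_triangle_swap tri) A11 A1 Ap Ar.
have nBr := no_common_geodesic tri B11 B1 Bp Bq.
have nCp := no_common_geodesic (hyperbolic_triangle_rotate tri) C11 C1 Cq Cr.
pose x := val A 0 0 * val B 0 0 + (val A 0 1 * val B 1 0 + val B 0 1 * val A 1 0) / 2.
pose y := val B 0 0 * val C 0 0 + (val B 0 1 * val C 1 0 + val C 0 1 * val B 1 0) / 2.
pose z := val A 0 0 * val C 0 0 + (val A 0 1 * val C 1 0 + val C 0 1 * val A 1 0) / 2.
have AA : val A *m val A = 1%:M by rewrite traceless_sqr// A1.
have BB : val B *m val B = 1%:M by rewrite traceless_sqr// B1.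
have CC : val C *m val C = 1%:M by rewrite traceless_sqr// C1.
have T : clifford_triple (val A) (val B) (val C) x y z.
  by split; split; rewrite ?traceless_anticommutator.
have tr0 (M : 'M[R]_2) : M 1 1 = - M 0 0 -> \tr (diagonal_mx n M) = 0.
  move=> hM; rewrite diagonal_trace; transitivity (n%:R * (M 0 0 + M 1 1) : R).
    by congr (_ * _); rewrite /mxtrace big_ord_recl big_ord1;
      congr (_ + M _ _); exact/val_inj.
  by rewrite hM subrr mulr0.
have := traceless_pseudoscalar A11 B11 C11 T; set e := (_ / 2) => eE.
exists (diagonal_mx n (val A)), (diagonal_mx n (val B)), (diagonal_mx n (val C)).
exists x, y, z, e; split; first by split; exact: diagonal_unimodular_lift.
split; first by split; exact: tr0.
have form0 (M : 'M[R]_2) s : geodesic_form M s = 0 ->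
    M 0 1 + 2 * complex.Re s * M 0 0 -
      (complex.Re s ^+ 2 + complex.Im s ^+ 2) * M 1 0 = 0 by [].
have formN (M : 'M[R]_2) s : geodesic_form M s <> 0 ->
    M 0 1 + 2 * complex.Re s * M 0 0 -
      (complex.Re s ^+ 2 + complex.Im s ^+ 2) * M 1 0 != 0.
  by move/eqP.
split; [exact: diagonal_clifford_triple|exact: diagonal_pseudoscalar| |].
  rewrite /e mulf_neq0 ?invr_eq0 ?pnatr_eq0//.
  exact: (det3_diagonal_forms_neq0 (form0 _ _ Bq) (form0 _ _ Cq)
    (form0 _ _ Ar) (form0 _ _ Cr) (form0 _ _ Ap) (form0 _ _ Bp)
    (formN _ _ nAq) (formN _ _ nBr) (formN _ _ nCp)).
apply: (polar_sqr_lt1 _ (form0 _ _ Ap) (form0 _ _ Bp) A1 B1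
  (form0 _ _ Bq) (formN _ _ nAq)).
by rewrite gt_eqF.
Qed.

(** * Relations and homomorphisms of the triangle group *)

Lemma pi_presentedM (I : choiceType) (rels : set (word I)) (v w : word I) :
  (\pi_(presented rels) v * \pi_(presented rels) w)%g = \pi_(presented rels) (v ++ w).
Proof.
by apply/pi_presented; apply: word_equiv_cat; exact: word_equiv_repr.
Qed.

Lemma pi_presented_rel (I : choiceType) (rels : set (word I)) (r : word I) :
  rels r -> \pi_(presented rels) r = 1%g.
Proof.
move=> rr; apply/pi_presented.
by have := @word_equiv_rel _ rels [::] r [::] rr; rewrite cats0.
Qed.

Lemma presented_morph_ext (I : choiceType) (rels : set (word I)) (G : groupType)
    (f f' : presented rels -> G) :
  {morph f : x y / (x * y)%g} -> {morph f' : x y / (x * y)%g} ->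
  (forall i, f (presented_gen rels i) = f' (presented_gen rels i)) -> f =1 f'.
Proof.
have morph1 (h : presented rels -> G) : {morph h : x y / (x * y)%g} -> h 1%g = 1%g.
  by move=> hM; apply: (mulgI (h 1%g)); rewrite -hM !mulg1.
move=> fM fM' ff'; elim/quotW => w; elim: w => [|x w IH].
  by rewrite [\pi_(_) _](_ : _ = 1%g)// !morph1.
rewrite -[x :: w]/([:: x] ++ w) -pi_presentedM fM fM' IH; congr (_ * _)%g.
case: x => i [] //; last exact: ff'.
have gV : (\pi_(presented rels) [:: (i, true)] * presented_gen rels i = 1)%g.
  rewrite pi_presentedM; apply/pi_presented.
  exact: (word_equiv_cancel rels [::] (i, true) [::]).
by apply: (mulIg (f (presented_gen rels i))); rewrite {2}ff' -fM -fM' gV !morph1.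
Qed.

Lemma group_morph1 (G H : groupType) (f : {multiplicative G -> H}) : f 1%g = 1%g.
Proof. by apply: (mulgI (f 1%g)); rewrite -gmulfM !mulg1. Qed.

Lemma group_morphX (G H : groupType) (f : {multiplicative G -> H}) (x : G) k :
  (f (x ^+ k) = f x ^+ k)%g.
Proof. by elim: k => [|k IH]; rewrite ?group_morph1// !expgS gmulfM IH. Qed.

Section TriangleRelations.
Variables k1 k2 k3 : nat.
Local Notation a := (tri_a k1 k2 k3).
Local Notation b := (tri_b k1 k2 k3).
Local Notation c := (tri_c k1 k2 k3).

Lemma pi_word_pow (w : word 'I_3) k :
  \pi_(triangle_group k1 k2 k3) (word_pow w k) = (\pi_(triangle_group k1 k2 k3) w ^+ k)%g.
Proof.
elim: k => [//|k IH]; rewrite expgS -IH.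
by rewrite [RHS]pi_presentedM.
Qed.

Lemma triangle_relations :
  [/\ (a * a = 1)%g, (b * b = 1)%g & (c * c = 1)%g] /\
  [/\ ((a * b) ^+ k1 = 1)%g, ((b * c) ^+ k2 = 1)%g & ((a * c) ^+ k3 = 1)%g].
Proof.
have rel r : triangle_relators k1 k2 k3 r -> \pi_(triangle_group k1 k2 k3) r = 1%g.
  exact: pi_presented_rel.
have sqr i : triangle_relators k1 k2 k3 (word_pow [:: letter i] 2) ->
    (presented_gen (triangle_relators k1 k2 k3) i *
     presented_gen (triangle_relators k1 k2 k3) i = 1)%g.
  by move=> ?; rewrite [LHS]pi_presentedM; exact: rel.
split; split.
1-3: by apply: sqr; rewrite /triangle_relators /= !inE eqxx ?orbT.
all: by rewrite [X in (X ^+ _)%g]pi_presentedM -pi_word_pow; apply: rel;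
  rewrite /triangle_relators /= !inE eqxx ?orbT.
Qed.

End TriangleRelations.

(** * Rigidity along a path *)

Section Rigidity.
Variables (R : realType) (m : nat) (G : groupType).
Hypothesis m_gt0 : (0 < m)%N.
Variable rho : R -> {multiplicative G -> PGL R m}.
Hypothesis rho_continuous :
  {within `[0, 1], continuous (fun t => rho t : {ptws G -> PGL R m})}.

Let mR0 : m%:R != 0 :> R. Proof. by rewrite pnatr_eq0 -lt0n. Qed.

Let trace_sqr_constant (g : G) (L : seq R) (A0 : 'M[R]_m) :
  unimodular_lift (rho 0 g) A0 ->
  (forall t N, 0 <= t <= 1 -> unimodular_lift (rho t g) N -> \tr N ^+ 2 \in L) ->
  forall t N, 0 <= t <= 1 -> unimodular_lift (rho t g) N -> \tr N ^+ 2 = \tr A0 ^+ 2.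
Proof.
move=> lA0 fin t N t01 lN.
rewrite -(trace_sqr_lift m_gt0 lN) -(trace_sqr_lift m_gt0 lA0).
apply: (@invariant_constant R G m (fun t => rho t) _ L) => //.
  exact: continuous_trace_sqr m_gt0.
move=> s s01; have [M lM] := unimodular_lift_exists m_gt0 (rho s g).
by rewrite (trace_sqr_lift m_gt0 lM); exact: fin lM.
Qed.

Let trace_of_sqr_constant (g : G) (L : seq R) (A0 : 'M[R]_m) :
  unimodular_lift (rho 0 g) A0 ->
  (forall t N, 0 <= t <= 1 -> unimodular_lift (rho t g) N -> \tr (N *m N) \in L) ->
  forall t N, 0 <= t <= 1 -> unimodular_lift (rho t g) N -> \tr (N *m N) = \tr (A0 *m A0).
Proof.
move=> lA0 fin t N t01 lN.
rewrite -(trace_of_sqr_lift m_gt0 lN) -(trace_of_sqr_lift m_gt0 lA0).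
apply: (@invariant_constant R G m (fun t => rho t) _ L) => //.
  exact: continuous_trace_of_sqr m_gt0.
move=> s s01; have [M lM] := unimodular_lift_exists m_gt0 (rho s g).
by rewrite (trace_of_sqr_lift m_gt0 lM); exact: fin lM.
Qed.

(** The lift has order dividing [k * 2] rather than [k], because its power [k] is
    only known to be 1 or -1. *)
Lemma torsion_traces_constant (g : G) (k : nat) (A0 : 'M[R]_m) :
  (0 < k)%N -> (g ^+ k = 1)%g -> unimodular_lift (rho 0 g) A0 ->
  forall t N, 0 <= t <= 1 -> unimodular_lift (rho t g) N ->
    \tr N ^+ 2 = \tr A0 ^+ 2 /\ \tr (N *m N) = \tr (A0 *m A0).
Proof.
move=> k_gt0 gk1 lA0.
have k2_gt0 : (0 < k * 2)%N by rewrite muln_gt0 k_gt0.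
have [L LE] := mxtrace_torsion_finite R m k2_gt0.
have torsion t N : unimodular_lift (rho t g) N -> N ^+ (k * 2) = 1.
  move=> lN; apply: (unimodular_lift_torsion m_gt0 lN).
  by rewrite -group_morphX gk1 group_morph1.
move=> t N t01 lN; split.
  apply: (trace_sqr_constant (L := [seq u ^+ 2 | u <- L]) lA0 _ t01 lN) => s M s01 lM.
  by apply/map_f/LE; exact: torsion lM.
apply: (trace_of_sqr_constant (L := L) lA0 _ t01 lN) => s M s01 lM.
by apply: LE; rewrite -[M *m M]/(M ^+ 2) -exprM mulnC exprM (torsion _ _ lM) expr1n.
Qed.

(** A lift of an involution has square 1 or -1, and the trace of the square
    distinguishes the two. *)
Lemma involution_stays (g : G) (A0 : 'M[R]_m) :
  (g * g = 1)%g -> unimodular_lift (rho 0 g) A0 -> A0 *m A0 = 1%:M -> \tr A0 = 0 ->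
  forall t N, 0 <= t <= 1 -> unimodular_lift (rho t g) N ->
    N *m N = 1%:M /\ \tr N = 0.
Proof.
move=> gg lA0 AA trA t N t01 lN.
have gg2 : (g ^+ 2 = 1)%g by rewrite expgS expg1.
have [e1 e2] := torsion_traces_constant (ltn0Sn 1) gg2 lA0 t01 lN.
have lNN := unimodular_liftM lN lN; rewrite -gmulfM gg group_morph1 in lNN.
have [s s1 E] := unimodular_lift_uniq m_gt0 lNN (unimodular_lift1 R m).
split; last by move/eqP: e1; rewrite trA expr0n/= sqrf_eq0 => /eqP.
move: e2; rewrite E AA mxtraceZ mxtrace1 -[X in _ = X]mul1r => /(mulIf mR0) ->.
by rewrite scale1r.
Qed.

(** The product X = AB has finite order and inverse BA.  The invariants
    tr(X)^2 and tr(X^2) give the trace of (X + X^-1 - 2y)^2, where y = tr(X)/m, and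
    it is zero because it is zero at time 0. *)
Lemma anticommutator_stays (g h : G) (k : nat) (A0 B0 : 'M[R]_m) (x : R) :
  (0 < k)%N -> ((g * h) ^+ k = 1)%g ->
  unimodular_lift (rho 0 g) A0 -> unimodular_lift (rho 0 h) B0 ->
  A0 *m A0 = 1%:M -> B0 *m B0 = 1%:M -> A0 *m B0 + B0 *m A0 = (2 * x)%:M ->
  forall t A B, 0 <= t <= 1 ->
    unimodular_lift (rho t g) A -> unimodular_lift (rho t h) B ->
    A *m A = 1%:M -> B *m B = 1%:M ->
    exists2 y, y ^+ 2 = x ^+ 2 & A *m B + B *m A = (2 * y)%:M.
Proof.
move=> k_gt0 ghk lA0 lB0 AA0 BB0 AB0 t A B t01 lA lB AA BB.
have l0 := unimodular_liftM lA0 lB0; have l := unimodular_liftM lA lB.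
rewrite -!gmulfM in l0 l.
have [e1 e2] := torsion_traces_constant k_gt0 ghk l0 t01 l.
have T0 : \tr (A0 *m B0) = m%:R * x by exact: trace_product AB0.
have T1 : \tr (A0 *m B0 *m (A0 *m B0)) = m%:R * (2 * x ^+ 2 - 1).
  have BA : B0 *m A0 = (2 * x)%:M - A0 *m B0 by rewrite -AB0 [X in X - _]addrC addrK.
  rewrite mulmxA -(mulmxA A0) BA mulmxBr mulmxBl mul_mx_scalar -scalemxAl.
  rewrite mulmxA AA0 mul1mx BB0.
  by rewrite raddfB/= mxtraceZ T0 mxtrace1; ring.
rewrite T0 in e1; rewrite T1 in e2.
pose y := \tr (A *m B) / m%:R.
have trE : \tr (A *m B) = m%:R * y by rewrite mulrC divfK.
have yx : y ^+ 2 = x ^+ 2.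
  by apply: (mulfI (expf_neq0 2 mR0)); rewrite -!exprMn -trE.
exists y => //.
have k2_gt0 : (0 < k * 2)%N by rewrite muln_gt0 k_gt0.
have tors : (A *m B) ^+ (k * 2) = 1.
  by apply: (unimodular_lift_torsion m_gt0 l); rewrite -group_morphX ghk group_morph1.
have YX : B *m A *m (A *m B) = 1%:M by rewrite mulmxA -(mulmxA B) AA mulmx1.
have XY : A *m B *m (B *m A) = 1%:M by rewrite mulmxA -(mulmxA A) BB mulmx1.
apply: (torsion_plus_inverse_scalar k2_gt0 tors YX).
have trBA : \tr (B *m A) = m%:R * y by rewrite mxtrace_mulC.
have trBABA : \tr (B *m A *m (B *m A)) = m%:R * (2 * x ^+ 2 - 1).
  by rewrite -e2 mxtrace_mulC -!mulmxA mxtrace_mulC !mulmxA.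
rewrite mxtrace_shift_sqr mulmxDl !mulmxDr YX XY !raddfD/= e2 trBABA mxtrace_scalar_mull.
by rewrite trE trBA -yx; ring.
Qed.

(** The element abac has infinite order in general, but the squared trace of its
    lift is determined by the squares of x, y, z and the sign of xyz, so that it
    still takes at most two values. *)
Lemma product_of_cosines_stays (a b c : G) (A0 B0 C0 : 'M[R]_m) (x0 y0 z0 : R) :
  unimodular_lift (rho 0 a) A0 -> unimodular_lift (rho 0 b) B0 ->
  unimodular_lift (rho 0 c) C0 -> clifford_triple A0 B0 C0 x0 y0 z0 ->
  (forall t A B C, 0 <= t <= 1 ->
    unimodular_lift (rho t a) A -> unimodular_lift (rho t b) B ->
    unimodular_lift (rho t c) C -> exists x y z,
      [/\ x ^+ 2 = x0 ^+ 2, y ^+ 2 = y0 ^+ 2, z ^+ 2 = z0 ^+ 2 & clifford_triple A B C x y z]) ->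
  forall t A B C x y z, 0 <= t <= 1 ->
    unimodular_lift (rho t a) A -> unimodular_lift (rho t b) B ->
    unimodular_lift (rho t c) C ->
    x ^+ 2 = x0 ^+ 2 -> y ^+ 2 = y0 ^+ 2 -> z ^+ 2 = z0 ^+ 2 ->
    clifford_triple A B C x y z -> x * y * z = x0 * y0 * z0.
Proof.
move=> lA0 lB0 lC0 T0 triples t A B C x y z t01 lA lB lC ex ey ez T.
pose val (u : R) := (m%:R : R) ^+ 2 * (4 * x0 ^+ 2 * z0 ^+ 2 + y0 ^+ 2 - 4 * u).
have traceE (x' y' z' : R) : x' ^+ 2 = x0 ^+ 2 -> y' ^+ 2 = y0 ^+ 2 -> z' ^+ 2 = z0 ^+ 2 ->
    (m%:R * (2 * x' * z' - y')) ^+ 2 = val (x' * y' * z').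
  by move=> ex' ey' ez'; rewrite /val -ex' -ey' -ez'; ring.
have l0 := unimodular_liftM (unimodular_liftM lA0 lB0) (unimodular_liftM lA0 lC0).
have l := unimodular_liftM (unimodular_liftM lA lB) (unimodular_liftM lA lC).
rewrite -!gmulfM in l0 l.
pose p0 := x0 * y0 * z0.
have fin s N : 0 <= s <= 1 -> unimodular_lift (rho s (a * b * (a * c))%g) N ->
    \tr N ^+ 2 \in [:: val p0; val (- p0)].
  move=> s01 lN; rewrite -(trace_sqr_lift m_gt0 lN).
  have [A' lA'] := unimodular_lift_exists m_gt0 (rho s a).
  have [B' lB'] := unimodular_lift_exists m_gt0 (rho s b).
  have [C' lC'] := unimodular_lift_exists m_gt0 (rho s c).
  have [x' [y' [z' [ex' ey' ez' T']]]] := triples _ _ _ _ s01 lA' lB' lC'.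
  have l' := unimodular_liftM (unimodular_liftM lA' lB') (unimodular_liftM lA' lC').
  rewrite -!gmulfM in l'; rewrite (trace_sqr_lift m_gt0 l') (trace_ABAC T') traceE//.
  have /eqP : (x' * y' * z') ^+ 2 = p0 ^+ 2 by rewrite /p0 !exprMn ex' ey' ez'.
  by rewrite eqf_sqr => /orP[/eqP->|/eqP->]; rewrite !inE eqxx ?orbT.
have := trace_sqr_constant l0 fin t01 l.
rewrite (trace_ABAC T) (trace_ABAC T0) !traceE// /val => /(mulfI (expf_neq0 2 mR0)).
lra.
Qed.

(** The lifts are adjusted in two steps: their separate signs fix the Gram
    matrix, and a common sign, which leaves the Gram matrix alone and changes the
    sign of the pseudoscalar, then fixes the latter. *)
Lemma clifford_triple_stays (a b c : G) (k1 k2 k3 : nat)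
    (A0 B0 C0 : 'M[R]_m) (x y z e : R) :
  (0 < k1)%N -> (0 < k2)%N -> (0 < k3)%N ->
  [/\ (a * a = 1)%g, (b * b = 1)%g & (c * c = 1)%g] ->
  [/\ ((a * b) ^+ k1 = 1)%g, ((b * c) ^+ k2 = 1)%g & ((a * c) ^+ k3 = 1)%g] ->
  [/\ unimodular_lift (rho 0 a) A0, unimodular_lift (rho 0 b) B0 &
      unimodular_lift (rho 0 c) C0] ->
  [/\ \tr A0 = 0, \tr B0 = 0 & \tr C0 = 0] ->
  clifford_triple A0 B0 C0 x y z -> pseudoscalar A0 B0 C0 x y z = e%:M -> e != 0 ->
  forall t, 0 <= t <= 1 -> exists A B C,
    [/\ unimodular_lift (rho t a) A, unimodular_lift (rho t b) B &
      unimodular_lift (rho t c) C] /\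
    clifford_triple A B C x y z /\ pseudoscalar A B C x y z = e%:M.
Proof.
move=> k1_gt0 k2_gt0 k3_gt0 [aa bb cc] [abk bck ack] [lA0 lB0 lC0] [trA0 trB0 trC0] T0 P0 e0.
have [[AA0 BB0 CC0] [AB0 BC0 AC0]] := T0.
have invA := involution_stays aa lA0 AA0 trA0.
have invB := involution_stays bb lB0 BB0 trB0.
have invC := involution_stays cc lC0 CC0 trC0.
have triples t A B C : 0 <= t <= 1 ->
    unimodular_lift (rho t a) A -> unimodular_lift (rho t b) B ->
    unimodular_lift (rho t c) C -> exists x' y' z',
      [/\ x' ^+ 2 = x ^+ 2, y' ^+ 2 = y ^+ 2, z' ^+ 2 = z ^+ 2 & clifford_triple A B C x' y' z'].
  move=> t01 lA lB lC.
  have [AA _] := invA _ _ t01 lA; have [BB _] := invB _ _ t01 lB.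
  have [CC _] := invC _ _ t01 lC.
  have [x' ex AB] := anticommutator_stays k1_gt0 abk lA0 lB0 AA0 BB0 AB0 t01 lA lB AA BB.
  have [y' ey BC] := anticommutator_stays k2_gt0 bck lB0 lC0 BB0 CC0 BC0 t01 lB lC BB CC.
  have [z' ez AC] := anticommutator_stays k3_gt0 ack lA0 lC0 AA0 CC0 AC0 t01 lA lC AA CC.
  by exists x', y', z'.
have gram t : 0 <= t <= 1 -> exists A B C,
    [/\ unimodular_lift (rho t a) A, unimodular_lift (rho t b) B &
      unimodular_lift (rho t c) C] /\ clifford_triple A B C x y z.
  move=> t01.
  have [A lA] := unimodular_lift_exists m_gt0 (rho t a).
  have [B lB] := unimodular_lift_exists m_gt0 (rho t b).
  have [C lC] := unimodular_lift_exists m_gt0 (rho t c).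
  have [x' [y' [z' [ex ey ez T]]]] := triples _ _ _ _ t01 lA lB lC.
  have P := product_of_cosines_stays lA0 lB0 lC0 T0 triples t01 lA lB lC ex ey ez T.
  have [r [s [u [[r1 s1 u1] [<- <- <-]]]]] := normalize_signs ex ey ez P.
  exists (r *: A), (s *: B), (u *: C); split; last exact: clifford_triple_signs.
  by split; exact: unimodular_lift_sign.
have e2E : x ^+ 2 + y ^+ 2 + z ^+ 2 - 2 * x * y * z - 1 = e ^+ 2.
  have := pseudoscalar_sqr T0; rewrite P0 -scalar_mxM -expr2.
  move=> /(congr1 mxtrace); rewrite !mxtrace_scalar_mull => /(mulfI mR0) <-//.
(* J is an involution, and tr(ABC) = e tr(J) since A, B, C have trace zero. *)
have scaled t A B C : 0 <= t <= 1 ->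
    unimodular_lift (rho t a) A -> unimodular_lift (rho t b) B ->
    unimodular_lift (rho t c) C -> clifford_triple A B C x y z ->
    let J := e^-1 *: pseudoscalar A B C x y z in
    J *m J = 1%:M /\ \tr (A *m B *m C) = e * \tr J.
  move=> t01 lA lB lC T J; split.
    rewrite /J -scalemxAl -scalemxAr scalerA (pseudoscalar_sqr T) e2E scale_scalar_mx.
    by rewrite -expr2 exprVn mulVf// expf_neq0.
  rewrite mxtraceZ mulVKf// /pseudoscalar raddfB raddfD raddfB/= !mxtraceZ.
  have [_ ->] := invA _ _ t01 lA; have [_ ->] := invB _ _ t01 lB.
  by have [_ ->] := invC _ _ t01 lC; rewrite !mulr0 subrr addr0 subr0.
have [L LE] := mxtrace_torsion_finite R m (ltn0Sn 1).
have l0 := unimodular_liftM (unimodular_liftM lA0 lB0) lC0; rewrite -!gmulfM in l0.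
have fin s N : 0 <= s <= 1 -> unimodular_lift (rho s (a * b * c)%g) N ->
    \tr N ^+ 2 \in [seq (e * v) ^+ 2 | v <- L].
  move=> s01 lN; rewrite -(trace_sqr_lift m_gt0 lN).
  have [A [B [C [[lA lB lC] T]]]] := gram s s01.
  have l := unimodular_liftM (unimodular_liftM lA lB) lC; rewrite -!gmulfM in l.
  have [JJ trJ] := scaled _ _ _ _ s01 lA lB lC T.
  rewrite (trace_sqr_lift m_gt0 l) trJ; apply: map_f; exact: LE.
move=> t t01.
have [A [B [C [[lA lB lC] T]]]] := gram t t01.
have l := unimodular_liftM (unimodular_liftM lA lB) lC; rewrite -!gmulfM in l.
have [JJ trJ] := scaled _ _ _ _ t01 lA lB lC T.
have zero01 : 0 <= (0 : R) <= 1.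
  by rewrite lexx ler01.
have [_ trJ0] := scaled _ _ _ _ zero01 lA0 lB0 lC0 T0.
have := trace_sqr_constant l0 fin t01 l.
rewrite trJ trJ0 P0 scale_scalar_mx mulVf// mxtrace1 !exprMn => /(mulfI (expf_neq0 2 e0)).
move=> /eqP; rewrite eqf_sqr => trJE.
have [s s1 trs] : exists2 s : R, s ^+ 2 = 1 &
    \tr (e^-1 *: pseudoscalar A B C x y z) = m%:R * s.
  by case/orP: trJE => /eqP ->; [exists 1|exists (-1)];
    rewrite ?sqrrN ?expr1n ?mulr1 ?mulrN1.
have Jscal := involution_extremal_trace JJ s1 trs.
have hE : pseudoscalar A B C x y z = (e * s)%:M.
  by rewrite -scale_scalar_mx -Jscal scalerA mulfV// scale1r.
have ss (v : R) : s * s * v = v by rewrite -expr2 s1 mul1r.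
exists (s *: A), (s *: B), (s *: C); split; first by split; exact: unimodular_lift_sign.
split; first by have := clifford_triple_signs s1 s1 s1 T; rewrite !ss.
by rewrite pseudoscalar_sign// hE scale_scalar_mx mulrCA -expr2 s1 mulr1.
Qed.
End Rigidity.

Theorem theorem1 (R : realType) (k1 k2 k3 n : nat)
    (k1_gt0 : (0 < k1)%N) (k2_gt0 : (0 < k2)%N) (k3_gt0 : (0 < k3)%N)
    (hyperbolic : (k1%:R^-1 + k2%:R^-1 + k3%:R^-1 : R) < 1)
    (n_gt0 : (0 < n)%N)
    (rho_geom : {multiplicative triangle_group k1 k2 k3 -> PGL R 2})
    (geom : geometric_rep rho_geom)
    (rho : R -> {multiplicative triangle_group k1 k2 k3 -> PGL R (n * 2)})
    (rho_continuous : {within `[0, 1],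
       continuous (fun t => rho t : {ptws triangle_group k1 k2 k3 -> PGL R (n * 2)})})
    (rho0 : rho 0 =1 diag_rep n \o rho_geom) :
  forall t : R, 0 <= t <= 1 -> conjugate_reps (rho t) (diag_rep n \o rho_geom).
Proof.
move=> t t01.
have n2_gt0 : (0 < n * 2)%N by rewrite muln_gt0 n_gt0.
have [A0 [B0 [C0 [x [y [z [e [lifts [traces [T0 P0 e0 x1]]]]]]]]]] :=
  geometric_clifford_triple n_gt0 geom.
have [squares powers] := triangle_relations k1 k2 k3.
have lifts0 := lifts; rewrite -![diag_rep n (rho_geom _)]rho0 in lifts0.
have [A [B [C [[lA lB lC] [T P]]]]] := clifford_triple_stays n2_gt0 rho_continuous
  k1_gt0 k2_gt0 k3_gt0 squares powers lifts0 traces T0 P0 e0 t01.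
have [g gu [gA gB gC]] := clifford_triples_conjugate x1 T0 T P0 P.
have [lA0 lB0 lC0] := lifts.
pose g' : GL R (n * 2) := exist (fun M => M \in unitmx) g gu.
exists (\pi_(PGL R (n * 2)) g').
apply: presented_morph_ext => [u v|u v|i].
- exact: gmulfM.
- by rewrite /= !gmulfM !mulgA mulgVK.
have iE : i = inord i by rewrite inord_val.
case: i iE => -[|[|[|//]]] ? ->.
- exact: (conjugate_unimodular_lift (g := g') lA lA0).
- exact: (conjugate_unimodular_lift (g := g') lB lB0).
- exact: (conjugate_unimodular_lift (g := g') lC lC0).
Qed.
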